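(* There is a universal constant $c>0$ such that the following holds for every $K\ge2$, every horizon $T$, every instance, every $C\ge0$, every attack policy whose total attack is at most $C$, and every $\delta\in(0,1)$. (i) The algorithm SE-WR-Stop with inputs $C,K,T,\delta$ and stopping condition $N_k\le \frac TK+C\sqrt{\frac{T}{K\log(KT/\delta)}}$ satisfies, with probability at least $1-\delta$, $$R_T\le c\left(\sqrt{KT\log(KT/\delta)}+KC\right).$$ (ii) The algorithm SE-WR-Stop with inputs $C,K,T,\delta$ and stopping condition $N_k\le\frac TK$ satisfies, with probability at least $1-\delta$, $$R_T\le c\,\sqrt{KT\,(\log(KT/\delta)+C)}.$$
   Context: Stochastic multi-armed bandit with adversarial attacks. There are $K$ arms $\mathcal K=\{1,\dots,K\}$; arm $k$ has a reward distribution on $[0,1]$ with unknown mean $\mu_k$ (the tuple of distributions is the instance), and rewards $X_{k,t}$ are drawn independently over rounds $t$ from arm $k$'s distribution. The arm of highest mean $k^*$ is assumed unique. In each round $t=1,\dots,T$: the learner pulls an arm $I_t$; the reward $X_{I_t,t}$ is drawn; the adversary observes $I_t$ and $X_{I_t,t}$ (and the past) and chooses an attacked reward $\tilde X_{I_t,t}$; the learner observes only $\tilde X_{I_t,t}$. The total attack is $\sum_{t=1}^T|X_{I_t,t}-\tilde X_{I_t,t}|$. Realized regret: $R_T=\max_{k\in\mathcal K}\sum_{t=1}^T(X_{k,t}-X_{I_t,t})$ (raw rewards). Algorithm SE-WR-Stop (inputs $C,K,T,\delta$ and a stopping condition of the form $N_k\le B$): initialize $\mathcal S=\mathcal K$,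 $N_k=0$, $\hat\mu_k=0$ for all $k$. While $N_k\le B$ (where $N_k$ is the common number of pulls of the arms $k\in\mathcal S$) and fewer than $T$ rounds have been used, repeat: pull each arm in $\mathcal S$ once; for $k\in\mathcal S$ increase $N_k$ by $1$ and let $\hat\mu_k$ be the empirical mean of the attacked rewards observed from arm $k$ so far; set $\hat\mu_{\max}=\max_k\hat\mu_k$; replace $\mathcal S$ by $$\Big\{k\in\mathcal S:\ \hat\mu_k\ge\hat\mu_{\max}-2\Big(\sqrt{\tfrac{\log(2KT/\delta)}{N_k}}+\tfrac{C}{N_k}\Big)\Big\}.$$ After the loop ends, pull the arms in $\mathcal S$ uniformly (round-robin) until round $T$. *)

(* Defs.v *)
From HB Require Import structures.
From mathcomp Require Import all_boot all_order all_algebra.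
From mathcomp Require Import all_classical all_reals all_analysis.

Set Implicit Arguments.
Unset Strict Implicit.
Unset Printing Implicit Defensive.
Import Order.TTheory GRing.Theory Num.Theory numFieldNormedType.Exports.

Local Open Scope classical_set_scope.
Local Open Scope ring_scope.

(* Conventions: the K arms are the elements of 'I_K and the rounds are numbered
   from 0, so that the horizon T means the rounds 0, ..., T-1. *)

Section Stochastic_model.
Variables (R : realType) (K : nat).

Definition arm_mean (nu : 'I_K -> probability R R)
  (k : 'I_K) : R := \int[nu k]_x x.

Definition bandit_instance (nu : 'I_K -> probability R R) :=
  (forall k, nu k `[0%R, 1%R]%classic = 1%E) /\
  exists kstar, forall k, k != kstar -> arm_mean nu k < arm_mean nu kstar.

Variables (d : measure_display) (Omega : measurableType d).
Variable P : probability Omega R.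

Definition rewards_distributed (T : nat)
    (nu : 'I_K -> probability R R)
    (X : 'I_K -> nat -> {RV P >-> R}) :=
  forall (k : 'I_K) (t : nat), (t < T)%N ->
  forall A : set R, measurable A ->
    distribution P (X k t) A = nu k A.

(* Mutual independence of the adversary's internal randomness U and of the
   reward vectors (X k t)_k of the rounds t < T, on rectangles, which generate
   the sigma-algebras involved.  Subfamilies are covered by full sets A, B k t.
   Nothing is required of the joint law of the rewards of one round. *)
Definition independent_rounds (T : nat) (dW : measure_display)
    (W : measurableType dW) (U : {mfun Omega >-> W})
    (X : 'I_K -> nat -> {RV P >-> R}) :=
  forall (A : set W) (B : 'I_K -> nat -> set R),
    measurable A -> (forall k t, measurable (B k t)) ->
    P [set w | A (U w) /\ forall k t, (t < T)%N -> B k t (X k t w)] =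
    (P (U @^-1` A) *
     \prod_(t < T) P [set w | forall k, B k t (X k t w)])%E.

End Stochastic_model.

Section Interaction.
Variables (R : realType) (K : nat).

(* One entry (I_t, (X_{I_t,t}, attacked X_{I_t,t})) per round, oldest first. *)
Definition history := seq ('I_K * (R * R)).

Definition observed (h : history) : seq ('I_K * R) :=
  [seq (e.1, e.2.2) | e <- h].

Definition learner := seq ('I_K * R) -> 'I_K.

(* adv u h i x is the attacked reward when u is the internal randomness of the
   adversary, h the past, i the arm pulled and x its raw reward. *)
Definition attack_policy (W : Type) := W -> history -> 'I_K -> R -> R.

(* Joint measurability in the randomness and in all the rewards seen, for each
   fixed sequence of pulled arms. *)
Definition measurable_attack (dW : measure_display) (W : measurableType dW)
    (adv : attack_policy W) :=
  forall (n : nat) (a : n.-tuple 'I_K) (i : 'I_K),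
    measurable_fun [set: W * n.-tuple (R * R) * R]
      (fun p => adv p.1.1 (zip a p.1.2) i p.2).

Variables (pi : learner) (adv : history -> 'I_K -> R -> R).
Variable x : 'I_K -> nat -> R.

(* The history of the first t rounds when the raw rewards are x. *)
Fixpoint play (t : nat) : history :=
  if t is s.+1 then
    let h := play s in
    let i := pi (observed h) in
    rcons h (i, (x i s, adv h i (x i s)))
  else [::].

Definition pulled (t : nat) : 'I_K := pi (observed (play t)).

Definition total_attack (T : nat) : R :=
  \sum_(e <- play T) `|e.2.1 - e.2.2|.

(* k0 only seeds the maximum over the (nonempty) set of arms. *)
Definition regret (k0 : 'I_K) (T : nat) : R :=
  let gain k := \sum_(0 <= t < T) (x k t - x (pulled t) t) in
  \big[Num.max/gain k0]_(k : 'I_K) gain k.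

End Interaction.

Section SE_WR_Stop.
Variables (R : realType) (K : nat) (k0 : 'I_K).
Variables (C : R) (T : nat) (delta B : R).

(* [npulls] is the common value of N_k for k in [active], [total k] the sum of
   the attacked rewards observed from arm k, and [queue] lists the arms still to
   be pulled in the current sweep over [active] (in increasing order). *)
Record se_state := SeState {
  active : {set 'I_K};
  npulls : nat;
  total : 'I_K -> R;
  queue : seq 'I_K }.

Definition se_init : se_state :=
  SeState [set: 'I_K] 0 (fun=> 0) (enum [set: 'I_K]).

Definition se_width (n : nat) : R :=
  Num.sqrt (ln (2 * K%:R * T%:R / delta) / n%:R) + C / n%:R.

(* [i] is an element of S, used to seed the maximum over S. *)
Definition se_eliminate (S : {set 'I_K}) (n : nat) (muhat : 'I_K -> R)
    (i : 'I_K) : {set 'I_K} :=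
  let muhat_max := \big[Num.max/muhat i]_(k in S) muhat k in
  [set k in S | muhat_max - 2 * se_width n <= muhat k].

(* Processing the attacked reward y of the arm i just pulled.  The count
   [npulls] stays constant during a sweep and is frozen once it exceeds B, so
   the test npulls <= B made at the end of a sweep is the loop test made at its
   beginning.  When it fails, the sweeps are those of the final round-robin. *)
Definition se_update (st : se_state) (iy : 'I_K * R) : se_state :=
  let: (i, y) := iy in
  let total' := fun k => if k == i then total st k + y else total st k in
  if behead (queue st) is j :: q then
    SeState (active st) (npulls st) total' (j :: q)
  else if (npulls st)%:R <= B then
    let n := (npulls st).+1 in
    let S := se_eliminate (active st) n (fun k => total' k / n%:R) i in
    SeState S n total' (enum S)
  else SeState (active st) (npulls st) total' (enum (active st)).

(* The queue is never empty, so that the default value k0 is not used.  The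
   loop condition on the horizon is enforced by playing T rounds only. *)
Definition SE_WR_Stop : learner R K :=
  fun o => head k0 (queue (foldl se_update se_init o)).

End SE_WR_Stop.

Definition arm0 (K : nat) (hK : (2 <= K)%N) : 'I_K := Ordinal (ltnW hK).

Section Runs.
Variables (R : realType) (K : nat) (hK : (2 <= K)%N).
Variables (C : R) (T : nat) (delta B : R).
Variables (d : measure_display) (Omega : measurableType d).
Variables (P : probability Omega R) (X : 'I_K -> nat -> {RV P >-> R}).
Variables (dW : measure_display) (W : measurableType dW).
Variables (U : {mfun Omega >-> W}) (adv : attack_policy R K W).

Let alg := SE_WR_Stop (arm0 hK) C T delta B.

Definition se_total_attack (w : Omega) : R :=
  total_attack alg (adv (U w)) (fun k t => X k t w) T.

Definition se_regret (w : Omega) : R :=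
  regret alg (adv (U w)) (fun k t => X k t w) (arm0 hK) T.

End Runs.

(* Main.v *)
(* With l = ln (2KT/delta), Hoeffding's lemma makes
     exp (lambda Z_t - lambda^2 n_t / 8)
   a supermartingale, where Z_t sums the centered rewards of the arms chosen
   before round t by a predictable rule and n_t counts them.  One Markov
   inequality for the sum of finitely many such exponentials (at most 4 K^2 T^2
   of them, each tested at level exp (2l) = (2KT/delta)^2) shows that, with
   probability at least 1 - delta, the raw empirical sums of every arm after n
   pulls, of every fixed arm over the horizon, and of the arms actually pulled
   are within sqrt (l n) of their expectations.

   On this event the attacked empirical means after n sweeps are within
   w n = sqrt (l / n) + C / n of the true means, so the best arm survives every
   elimination and every arm that survives has gap at most 4 w n.  The pulls of
   arm k inside the loop therefore cost O (sqrt (l N_k) + C), hence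
   O (sqrt (l K T) + K C) over all arms by Cauchy-Schwarz, and each final pull
   costs at most 4 w n for some n > B.  In part (ii), when K C > T, the bound
   by the horizon T is already good enough. *)

Require Import Defs.
From HB Require Import structures.
From mathcomp Require Import all_boot all_order all_algebra.
From mathcomp Require Import all_classical all_reals all_analysis.
From mathcomp Require Import measurable_realfun ring lra.

Set Implicit Arguments.
Unset Strict Implicit.
Unset Printing Implicit Defensive.
Import Order.TTheory GRing.Theory Num.Theory numFieldNormedType.Exports.

Local Open Scope classical_set_scope.
Local Open Scope ring_scope.

(** * Hoeffding's lemma *)

Lemma ge_at0_of_derive_ge0 (R : realType) (f df : R -> R) (x : R) :
  (forall y, is_derive y (1 : R) f (df y)) -> (forall y, 0 <= y -> 0 <= df y) ->
  0 <= x -> f 0 <= f x.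
Proof.
move=> hf hdf x0.
have cf : {within `[0, x], continuous f}.
  apply: derivable_within_continuous => y _.
  by case: (hf y).
have [c /itvP c0 e] := MVT_segment x0 (fun y _ => hf y) cf.
by rewrite -subr_ge0 e mulr_ge0 ?subr0 // hdf ?c0.
Qed.

(** The difference [f] of the logarithms of the two sides vanishes at 0 together with its derivative
    [g], and its second derivative [dg] is nonnegative, so monotonicity is used twice. *)
Lemma bernoulli_mgf_ge0 (R : realType) (p x : R) : 0 <= p <= 1 -> 0 <= x ->
  1 - p + p * expR x <= expR (p * x + x ^+ 2 / 8).
Proof.
move=> /andP[p0 p1] x0.
have den y : 0 < 1 - p + p * expR y.
  have [->|p_neq0] := eqVneq p 0; first by rewrite subr0 mul0r addr0.
  by rewrite ltr_wpDl ?subr_ge0// mulr_gt0 ?expR_gt0// lt_neqAle eq_sym p_neq0.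
pose g y := p + y / 4 - p * expR y / (1 - p + p * expR y).
pose dg y := 1 / 4 - (1 - p) * (p * expR y) / (1 - p + p * expR y) ^+ 2.
pose f y := p * y + y ^+ 2 / 8 - ln (1 - p + p * expR y).
have hpe y : is_derive y (1 : R) (fun z => p * expR z) (p * expR y).
  by have := is_deriveZ p (is_derive_expR y).
have hden y : is_derive y (1 : R) (fun z => 1 - p + p * expR z) (p * expR y).
  by have := is_deriveD (is_derive_cst (1 - p) y (1 : R)) (hpe y); rewrite add0r.
have hV y : is_derive y (1 : R) (fun z => (1 - p + p * expR z)^-1)
    (- (1 - p + p * expR y) ^- 2 *: (p * expR y)).
  have [d1 d2] := hden y; have nz := lt0r_neq0 (den y).
  by apply: DeriveDef; [exact: derivableV|rewrite deriveV// d2].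
have hlin y (a : R) : is_derive y (1 : R) (fun z => a * z) a.
  by have := is_deriveZ a (is_derive_id y (1 : R)); rewrite /GRing.scale/= mulr1.
have hln y : is_derive y (1 : R) (fun z => ln (1 - p + p * expR z))
    ((1 - p + p * expR y)^-1 * (p * expR y)).
  exact: (@is_derive1_comp R (@ln R) (fun z => 1 - p + p * expR z) _ _ _
    (is_derive1_ln (den y)) (hden y)).
have hsq y : is_derive y (1 : R) (fun z => z ^+ 2 / 8) (y / 4).
  have := is_deriveZ (8^-1) (is_deriveX 2 (is_derive_id y (1 : R))).
  rewrite [X in is_derive _ _ X _](_ : _ = (fun z => z ^+ 2 / 8)); last first.
    by apply/funext => z; rewrite [LHS]mulrC.
  by move=> h; apply: is_derive_eq; rewrite /GRing.scale/= expr1; field.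
have hdg y : is_derive y (1 : R) g (dg y).
  have := is_deriveB (is_deriveD (is_derive_cst p y (1 : R)) (hlin y 4^-1))
    (is_deriveM (hpe y) (hV y)).
  rewrite [X in is_derive _ _ X _](_ : _ = g); last first.
    by apply/funext => z; rewrite /g [z / 4]mulrC.
  move=> h; apply: is_derive_eq; rewrite /GRing.scale/= /dg.
  by field; apply: lt0r_neq0; exact: den.
have hf y : is_derive y (1 : R) f (g y).
  have := is_deriveB (is_deriveD (hlin y p) (hsq y)) (hln y).
  by move=> h; apply: is_derive_eq; rewrite [_^-1 * _]mulrC.
have dg0 y : 0 <= dg y.
  rewrite /dg subr_ge0 ler_pdivrMr ?exprn_gt0//.
  (* With a = 1 - p and b = p e^y this is 4ab <= (a + b)^2. *)
  have := sqr_ge0 (1 - p - p * expR y); nra.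
have g0 y : 0 <= y -> 0 <= g y.
  move=> y0; apply: le_trans (ge_at0_of_derive_ge0 hdg (fun z _ => dg0 z) y0).
  by rewrite /g expR0 mul0r addr0 mulr1 subrK divr1 subrr.
have := ge_at0_of_derive_ge0 hf g0 x0.
rewrite /f expR0 mulr1 subrK ln1 expr0n/= mulr0 !mul0r addr0 subr0 => h.
rewrite -[leLHS]lnK ?posrE// ler_expR.
by rewrite -subr_ge0.
Qed.

(** Negative [x] reduces to the previous case at - x with 1 - p in place of [p], after
    multiplication by exp x. *)
Lemma bernoulli_mgf (R : realType) (p x : R) : 0 <= p <= 1 ->
  1 - p + p * expR x <= expR (p * x + x ^+ 2 / 8).
Proof.
move=> p01; have [x0|x0] := leP 0 x; first exact: bernoulli_mgf_ge0.
have p01' : 0 <= 1 - p <= 1 by lra.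
have x0' : 0 <= - x by lra.
have := bernoulli_mgf_ge0 p01' x0'.
rewrite -(ler_pM2r (expR_gt0 x)) mulrDl -mulrA -expRD addNr expR0 -expRD.
by congr (_ <= expR _); [ring|rewrite sqrrN; field].
Qed.

Lemma expR_le_chord (R : realType) (s x : R) : 0 <= x <= 1 ->
  expR (s * x) <= 1 - x + x * expR s.
Proof.
move=> x01.
have h : expR (x * s + (1 - x) * 0) <= x * expR s + (1 - x) * expR 0.
  exact: convex_expR (Itv01 (proj1 (andP x01)) (proj2 (andP x01))) s 0.
by rewrite mulrC; move: h; rewrite mulr0 addr0 expR0 mulr1 addrC.
Qed.

Section probability_on_unit_interval.
Variables (R : realType) (nu : probability R R).
Hypothesis nu01 : nu `[0%R, 1%R]%classic = 1%E.

Let D : set R := `[0%R, 1%R]%classic.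

Let mD : measurable D. Proof. exact: measurable_itv. Qed.

Let nuD : nu D = 1%E. Proof. exact: nu01. Qed.

Let nuDC : nu (~` D) = 0%E.
Proof. by rewrite probability_setC// nuD subee. Qed.

Let ge0_integral_unit (f : R -> \bar R) : measurable_fun setT f ->
  (forall x, (0 <= f x)%E) ->
  (\int[nu]_x f x = \int[nu]_(x in D) f x)%E.
Proof.
move=> mf f0.
by rewrite (ge0_negligible_integral (measurableC mD) _ mf _ nuDC)// setTD setCK.
Qed.

Let integrable_id : nu.-integrable D (EFin \o (@idfun R)).
Proof.
apply: measurable_bounded_integrable => //.
  by rewrite [X in (X < _)%E]nuD ltry.
- exact: measurable_id.
exists 1; split=> // M M1 x; rewrite /D/= in_itv/= => /andP[x0 x1].
by rewrite ger0_norm// (le_trans x1)// ltW.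
Qed.

Let integrable_idT : nu.-integrable setT (EFin \o (@idfun R)).
Proof.
apply/(negligible_integrable (measurableC mD) measurableT _ nuDC) => //.
  by apply/measurable_EFinP; exact: measurable_id.
by rewrite setTD setCK.
Qed.

Lemma integral_id_unit : (\int[nu]_x x = \int[nu]_(x in D) x)%R.
Proof.
rewrite /Rintegral (negligible_integral (measurableC mD) _ integrable_idT nuDC)//.
by rewrite setTD setCK.
Qed.

Lemma mean_unit_ge0_le1 : 0 <= \int[nu]_x x <= 1.
Proof.
rewrite integral_id_unit Rintegral_ge0/=; last first.
  by move=> x; rewrite /D/= in_itv/= => /andP[].
have -> : 1 = \int[nu]_(x in D) 1 by rewrite Rintegral_cst// mul1r [X in fine X]nuD.
apply: le_Rintegral => //.
  exact: finite_measure_integrable_cst.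
by move=> x; rewrite /D/= in_itv/= => /andP[].
Qed.

(** The chord bound replaces the law by the Bernoulli law of the same mean. Keeping s^2 / 8 inside
    the exponent makes this a factor of a supermartingale. *)
Lemma hoeffding_mgf (s : R) :
  (\int[nu]_x (expR (s * (x - \int[nu]_x x) - s ^+ 2 / 8))%:E <= 1)%E.
Proof.
set mu := \int[nu]_x x.
have mexp : measurable_fun setT
    (fun x : R => expR (s * (x - mu) - s ^+ 2 / 8)).
  apply: measurableT_comp => //; apply: measurable_funB => //.
  by apply: measurable_funM => //; apply: measurable_funB.
rewrite ge0_integral_unit; last 2 first.
- exact/measurable_EFinP.
- by move=> x; rewrite lee_fin expR_ge0.
pose c := expR (- (s * mu + s ^+ 2 / 8)).
have lin : forall x : R, c * (1 - x + x * expR s) = c + c * (expR s - 1) * x.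
  by move=> x; ring.
have int_lin : nu.-integrable D (EFin \o (fun x : R => c * (expR s - 1) * x)).
  exact: (integrableZl mD _ integrable_id).
have int_c : nu.-integrable D (EFin \o (fun=> c)).
  exact: finite_measure_integrable_cst.
apply: (@le_trans _ _ (\int[nu]_(x in D) (c + c * (expR s - 1) * x)%:E)%E).
  apply: ge0_le_integral => //.
  - exact/measurable_EFinP/measurable_funTS.
  - by apply/measurable_EFinP; apply: measurable_funD => //; apply: measurable_funM.
  move=> y; rewrite /D/= in_itv/= => y01.
  rewrite lee_fin -lin (_ : s * _ - _ = - (s * mu + s ^+ 2 / 8) + s * y); last by ring.
  by rewrite expRD ler_wpM2l ?expR_ge0// expR_le_chord.
have -> : (\int[nu]_(x in D) (c + c * (expR s - 1) * x)%:E)%E =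
   (c * (1 - mu + mu * expR s))%:E.
  rewrite lin -[LHS]fineK; last first.
    by apply: integrable_fin_num => //; exact: (integrableD mD int_c int_lin).
  congr EFin; rewrite -[LHS]/(\int[nu]_(x in D) (c + c * (expR s - 1) * x))%R.
  rewrite RintegralD// Rintegral_cst// [X in fine X]nuD mulr1.
  by rewrite (RintegralZl _ mD integrable_id)// -integral_id_unit.
rewrite lee_fin mulrC -ler_pdivlMr ?expR_gt0// div1r -expRN opprK.
by rewrite (mulrC s); apply: bernoulli_mgf; exact: mean_unit_ge0_le1.
Qed.

End probability_on_unit_interval.

(** * Exponential supermartingales of predictably sampled rewards *)

Section independence.
Variables (d : measure_display) (Omega : measurableType d) (R : realType).
Variables (P : probability Omega R) (d' : measure_display).
Variables (S : measurableType d') (G : set (set Omega)) (Z : Omega -> S).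
Hypotheses (Gm : G `<=` measurable) (GT : G setT) (GI : setI_closed G).
Hypothesis mZ : measurable_fun setT Z.
Hypothesis indepGZ : forall E B, G E -> measurable B ->
  (P (E `&` Z @^-1` B) = P E * P (Z @^-1` B))%E.

Let mZB B : measurable B -> measurable (Z @^-1` B).
Proof. by move=> mB; rewrite -[X in measurable X]setTI; exact: mZ. Qed.

(** Both sides, as functions of [E], are finite measures; they agree on the pi-system [G], hence on
    the sigma-algebra it generates. *)
Lemma independent_g_sigma E B : <<s G >> E -> measurable B ->
  (P (E `&` Z @^-1` B) = P E * P (Z @^-1` B))%E.
Proof.
move=> sE mB.
have mZB' := mZB mB.
have finP : P (Z @^-1` B) \is a fin_num by exact: fin_num_measure.
pose k : {nonneg R} := NngNum (fine_ge0 (measure_ge0 P (Z @^-1` B))).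
have kE : k%:num%:E = P (Z @^-1` B) by rewrite /= fineK.
rewrite muleC -kE.
apply: (@g_sigma_algebra_measure_unique _ _ _ G Gm (fun=> setT) _ _
  (mrestr P mZB') (mscale k P)) => //.
- by apply/seteqP; split=> // w _; exists 0%N.
- by move=> A GA; rewrite /= /mrestr /mscale kE muleC; exact: indepGZ.
- by move=> _; rewrite /= /mrestr setTI ltey_eq finP.
Qed.

Let GS := g_sigma_algebraType G.

Let sGm E : <<s G >> E -> measurable E.
Proof. by apply: smallest_sub => //; exact: sigma_algebra_measurable. Qed.

Lemma measurable_fun_coarser d1 (V : measurableType d1) (f : Omega -> V) :
  measurable_fun [set: GS] (f : GS -> V) -> measurable_fun setT f.
Proof.
by move=> mf _ B mB; rewrite setTI; apply: sGm; have := mf measurableT B mB; rewrite setTI.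
Qed.

(* The joint law of the identity, valued in the coarser sigma-algebra, and of Z
   is a product measure, so that Tonelli's theorem applies. *)
Lemma integral_independent (Y : Omega -> \bar R) (g : S -> \bar R) :
  measurable_fun [set: GS] (Y : GS -> \bar R) -> (forall w, 0 <= Y w)%E ->
  measurable_fun setT g -> (forall z, 0 <= g z)%E ->
  (\int[P]_w (Y w * g (Z w)) = \int[P]_w Y w * \int[P]_w g (Z w))%E.
Proof.
move=> mY Y0 mg g0.
have mid : measurable_fun setT (idfun : Omega -> GS).
  by move=> _ B mB; rewrite setTI; exact: sGm.
pose XY (w : Omega) : (GS * S)%type := (w, Z w).
have mXY : measurable_fun setT XY by apply/measurable_fun_pairP; split.
pose X1 : {mfun Omega >-> GS} := HB.pack (idfun : Omega -> GS)
  (isMeasurableFun.Build _ _ _ _ _ mid).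
pose X2 : {mfun Omega >-> S} := HB.pack Z (isMeasurableFun.Build _ _ _ _ _ mZ).
pose X3 : {mfun Omega >-> (GS * S)%type} := HB.pack XY
  (isMeasurableFun.Build _ _ _ _ _ mXY).
have uniq := @product_measure_unique _ _ _ _ R (distribution P X1)
  (distribution P X2) (distribution P X3)
  (fun A B mA mB => independent_g_sigma mA mB).
pose f (z : GS * S) := (Y z.1 * g z.2)%E.
have mf : measurable_fun setT f.
  apply: emeasurable_funM.
    by apply: (@measurableT_comp _ _ _ _ _ _ (Y : GS -> \bar R)).
  by apply: measurableT_comp.
have f0 z : (0 <= f z)%E by rewrite mule_ge0.
transitivity (\int[distribution P X3]_z f z)%E.
  by rewrite ge0_integral_distribution.
rewrite -(@eq_measure_integral _ _ _ _ _
  (distribution P X1 \x distribution P X2)%E); last first.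
  by move=> A mA _; rewrite /= uniq.
rewrite fubini_tonelli1// /fubini_F/=.
rewrite /f /=; under eq_integral => x _ do rewrite ge0_integralZl//.
transitivity (\int[distribution P X1]_x (Y x * \int[P]_w g (Z w)))%E.
  by apply: eq_integral => x _; rewrite ge0_integral_distribution.
rewrite ge0_integral_distribution//=; first last.
- by move=> x; rewrite mule_ge0// integral_ge0.
- by apply: emeasurable_funM.
rewrite ge0_integralZr//; first exact: measurable_fun_coarser.
exact: integral_ge0.
Qed.

End independence.

(** * The sigma-algebra of the past *)

Section past_sigma_algebra.
Variables (R : realType) (K T : nat) (d : measure_display).
Variables (Omega : measurableType d) (P : probability Omega R).
Variables (dW : measure_display) (W : measurableType dW).
Variables (U : {mfun Omega >-> W}) (X : 'I_K -> nat -> {RV P >-> R}).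
Hypothesis indepUX : independent_rounds T U X.

(** A pi-system generating the information before round [s]: the randomness of the adversary and the
    rewards of all arms, pulled or not, so that it does not depend on the learner. *)
Definition past_rectangles (s : nat) : set (set Omega) :=
  [set E | exists (A : set W) (B : 'I_K -> nat -> set R),
    [/\ measurable A, forall k t, measurable (B k t) &
     E = [set w | A (U w) /\ forall k t, (t < s)%N -> B k t (X k t w)]]].

Definition past (s : nat) := g_sigma_algebraType (past_rectangles s).

Lemma measurable_rounds s (B : 'I_K -> nat -> set R) :
  (forall k t, measurable (B k t)) ->
  measurable [set w | forall k t, (t < s)%N -> B k t (X k t w)].
Proof.
move=> mB.
rewrite [X in measurable X](_ : _ =
    \bigcap_(k : 'I_K) \bigcap_(t in [set t | (t < s)%N]) (X k t @^-1` B k t)).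
  apply: fin_bigcap_measurable => // k _.
  apply: bigcap_measurableType => t _.
  by rewrite -[X in measurable X]setTI; exact: measurable_funP.
by apply/seteqP; split=> w h k; [move=> _ t|move=> t]; apply: h.
Qed.

Lemma past_rectangles_measurable s : past_rectangles s `<=` measurable.
Proof.
move=> _ [A [B [mA mB ->]]].
rewrite [X in measurable X](_ : _ = U @^-1` A `&`
  [set w | forall k t, (t < s)%N -> B k t (X k t w)]) //.
apply: measurableI; last exact: measurable_rounds.
by rewrite -[X in measurable X]setTI; exact: measurable_funP.
Qed.

Lemma past_rectanglesT s : past_rectangles s setT.
Proof.
exists setT, (fun _ _ => setT); split=> //.
by apply/seteqP; split.
Qed.

Lemma past_rectanglesI s : setI_closed (past_rectangles s).
Proof.
move=> _ _ [A [B [mA mB ->]]] [A' [B' [mA' mB' ->]]].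
exists (A `&` A'), (fun k t => B k t `&` B' k t); split.
- exact: measurableI.
- by move=> k t; exact: measurableI.
apply/seteqP; split=> w /=.
  by move=> [[? h] [? h']]; split=> // k t ts; split; [exact: h|exact: h'].
by move=> [[? ?] h]; split; split=> // k t ts; case: (h k t ts).
Qed.

Lemma measurable_past_randomness s : measurable_fun [set: past s] (U : past s -> W).
Proof.
move=> _ A mA; rewrite setTI; apply: sub_sigma_algebra.
exists A, (fun _ _ => setT); split=> //.
by apply/seteqP; split=> w //= [].
Qed.

Lemma measurable_past_reward s k t : (t < s)%N ->
  measurable_fun [set: past s] (X k t : past s -> R).
Proof.
move=> ts _ B mB; rewrite setTI; apply: sub_sigma_algebra.
exists setT, (fun k' t' => if (k' == k) && (t' == t) then B else setT); split=> //.
  by move=> k' t'; case: ifP.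
apply/seteqP; split=> w /= h.
  by split=> // k' t' _; case: ifP => // /andP[/eqP-> /eqP->].
by case: h => _ /(_ k t ts); rewrite !eqxx.
Qed.

Lemma past_le s t E : (s <= t)%N -> <<s past_rectangles s >> E ->
  <<s past_rectangles t >> E.
Proof.
move=> st; apply: smallest_sub; first exact: smallest_sigma_algebra.
move=> _ [A [B [mA mB ->]]]; apply: sub_sigma_algebra.
exists A, (fun k r => if (r < s)%N then B k r else setT); split=> //.
  by move=> k r; case: ifP.
apply/seteqP; split=> w /= [Aw h]; split=> // k r.
  by move=> rt; case: ifP => // rs; exact: h.
by move=> rs; have := h k r (leq_trans rs st); rewrite rs.
Qed.

Lemma past_independent s k E B : (s < T)%N -> past_rectangles s E -> measurable B ->
  (P (E `&` X k s @^-1` B) = P E * P (X k s @^-1` B))%E.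
Proof.
move=> sT [A [B0 [mA mB0 ->]]] mB.
(* Both families restrict the rounds before [s] in the same way; [B2] in addition confines arm [k]
   to [B] in round [s]. The two products then differ only in the factor of round [s], which is 1 for
   [B1]. *)
pose B1 k t := if (t < s)%N then B0 k t else setT.
pose B2 k' t := if (t < s)%N then B0 k' t else
  if (t == s) && (k' == k) then B else setT.
have mB1 k' t : measurable (B1 k' t) by rewrite /B1; case: ifP.
have mB2 k' t : measurable (B2 k' t) by rewrite /B2; case: ifP => // _; case: ifP.
have := indepUX mA mB2; have := indepUX mA mB1.
rewrite (_ : [set w | A (U w) /\ forall k t, (t < T)%N -> B1 k t (X k t w)] =
  [set w | A (U w) /\ forall k t, (t < s)%N -> B0 k t (X k t w)]); last first.
  apply/seteqP; split=> w /= [Aw h]; split=> // k' t ht.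
    by have := h k' t (ltn_trans ht sT); rewrite /B1 ht.
  by rewrite /B1; case: ifP => // ts; exact: h.
rewrite (_ : [set w | A (U w) /\ forall k t, (t < T)%N -> B2 k t (X k t w)] =
  [set w | A (U w) /\ forall k t, (t < s)%N -> B0 k t (X k t w)] `&`
  X k s @^-1` B); last first.
  apply/seteqP; split=> w /=.
    move=> [Aw h]; split; first split=> // k' t ht.
      by have := h k' t (ltn_trans ht sT); rewrite /B2 ht.
    by have := h k s sT; rewrite /B2 ltnn !eqxx.
  move=> [[Aw h] Bw]; split=> // k' t ht.
  rewrite /B2; case: ifP => // ts; first exact: h.
  by case: ifP => // /andP[/eqP-> /eqP->].
move=> -> ->; rewrite -muleA; congr (_ * _)%E.
rewrite (bigD1 (Ordinal sT))//= [in RHS](bigD1 (Ordinal sT))//=.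
rewrite [X in (X * _)%E](_ : _ = P (X k s @^-1` B)); last first.
  congr (P _); apply/seteqP; split=> w /=.
    by move=> /(_ k); rewrite /B2 ltnn !eqxx.
  by move=> h k'; rewrite /B2 ltnn eqxx; case: eqP => // ->.
rewrite [X in _ = (X * _ * _)%E](_ : _ = 1%E); last first.
  rewrite -(probability_setT P); congr (P _); apply/seteqP; split=> w //= _ k'.
  by rewrite /B1 ltnn.
rewrite mul1e muleC; congr (_ * _)%E.
apply: eq_bigr => i /negbTE i_neq; congr (P _).
have {}i_neq : (i == s :> nat) = false by rewrite -i_neq.
by apply/seteqP; split=> w /= h k'; have := h k'; rewrite /B1 /B2 i_neq.
Qed.

End past_sigma_algebra.

(** * The supermartingale inequality *)

Section exponential_supermartingale.
Variables (R : realType) (K T : nat) (d : measure_display).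
Variables (Omega : measurableType d) (P : probability Omega R).
Variables (dW : measure_display) (W : measurableType dW).
Variables (U : {mfun Omega >-> W}) (X : 'I_K -> nat -> {RV P >-> R}).
Hypothesis indepUX : independent_rounds T U X.
Variables (mu : 'I_K -> R) (lambda : R).
Hypothesis mgf : forall k t, (t < T)%N ->
  (\int[P]_w (expR (lambda * (X k t w - mu k) - lambda ^+ 2 / 8))%:E <= 1)%E.
(* [sel t w] is the arm whose reward of round t is included, if any. *)
Variable sel : nat -> Omega -> option 'I_K.
Hypothesis msel : forall t o, (t < T)%N ->
  <<s past_rectangles U X t >> [set w | sel t w = o].

Definition selected_mgf (o : option 'I_K) t w : R :=
  if o is Some k then expR (lambda * (X k t w - mu k) - lambda ^+ 2 / 8) else 1.

(** This is exp (lambda Z_t - lambda^2 n_t / 8), with Z_t the centered sum and n_t the number of the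
    rewards selected before round [t], in product form so that the last round factors off. *)
Definition selected_exp (t : nat) (w : Omega) : R :=
  \prod_(s < t) selected_mgf (sel s w) s w.

Let sel_indic t o : Omega -> R := \1_[set w | sel t w = o].

(** A quantity depending on the random selection becomes a finite sum over fixed selections, to
    which measurability and independence apply term by term. *)
Let sel_indic_sum (F : option 'I_K -> R) t w :
  \sum_o sel_indic t o w * F o = F (sel t w).
Proof.
rewrite (bigD1 (sel t w))//= big1 ?addr0.
  by rewrite /sel_indic indicE mem_set// mul1r.
by move=> o /eqP neq; rewrite /sel_indic indicE memNset ?mul0r// => /esym.
Qed.

Let sel_indic_ge0 t o w : 0 <= sel_indic t o w.
Proof. by rewrite /sel_indic indicE. Qed.

Let measurable_sel_indic s t o : (s < T)%N -> (s <= t)%N ->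
  measurable_fun [set: past U X t] (sel_indic s o : past U X t -> R).
Proof. by move=> sT st; apply: measurable_indic; apply: past_le (msel o sT). Qed.

Let measurable_selected_mgf o s t : (s < t)%N ->
  measurable_fun [set: past U X t] (selected_mgf o s : past U X t -> R).
Proof.
move=> st; case: o => [k|]; rewrite /selected_mgf; last exact: measurable_cst.
apply: measurableT_comp => //; apply: measurable_funB => //.
by apply: measurable_funM => //; apply: measurable_funB => //; exact: measurable_past_reward.
Qed.

Lemma measurable_past_selected_exp t : (t <= T)%N ->
  measurable_fun [set: past U X t] (selected_exp t : past U X t -> R).
Proof.
move=> tT.
apply: (@measurable_prod _ (past U X t) R [set: past U X t] _ (index_enum _)
  (fun (s : 'I_t) (w : past U X t) => selected_mgf (sel s w) s w)) => s _.
have sT : (s < T)%N := leq_trans (ltn_ord s) tT.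
rewrite [X in measurable_fun _ X](_ : _ =
  (fun w => \sum_o sel_indic s o w * selected_mgf o s w)); last first.
  by apply/funext => w; rewrite (sel_indic_sum (fun o => selected_mgf o s w)).
apply: measurable_sum => o; apply: measurable_funM.
  by apply: measurable_sel_indic => //; exact: ltnW.
exact: measurable_selected_mgf.
Qed.

Lemma selected_exp_ge0 t w : 0 <= selected_exp t w.
Proof.
by apply: prodr_ge0 => s _; case: (sel s w) => [k|] //=; rewrite expR_ge0.
Qed.

Lemma measurable_selected_exp t : (t <= T)%N -> measurable_fun setT (selected_exp t).
Proof.
move=> tT; apply: (@measurable_fun_coarser _ _ (past_rectangles U X t)).
  exact: past_rectangles_measurable.
exact: measurable_past_selected_exp.
Qed.

(** Induction on [t]: on each event that fixes the selection of round [t], the earlier product is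
    measurable for the past, hence independent of the rewards of round [t], whose exponential factor
    has mean at most 1. *)
Lemma integral_selected_exp_le1 t : (t <= T)%N ->
  (\int[P]_w (selected_exp t w)%:E <= 1)%E.
Proof.
elim: t => [|t IH] tT.
  rewrite /selected_exp; under eq_integral do rewrite big_ord0.
  by rewrite integral_cst// mul1e probability_le1.
apply: le_trans (IH (ltnW tT)).
pose Y o w := sel_indic t o w * selected_exp t w.
have Y0 o w : (0 <= (Y o w)%:E)%E.
  by rewrite lee_fin mulr_ge0 ?sel_indic_ge0 ?selected_exp_ge0.
have mY o : measurable_fun [set: past U X t] (EFin \o (Y o : past U X t -> R)).
  apply/measurable_EFinP/measurable_funM; first exact: measurable_sel_indic.
  exact: measurable_past_selected_exp (ltnW tT).
have sub := @past_rectangles_measurable _ _ _ _ P _ _ U X t.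
have mY' o : measurable_fun setT (EFin \o Y o).
  exact: (@measurable_fun_coarser _ _ _ sub _ _ (EFin \o Y o) (mY o)).
have g0 o w : (0 <= (selected_mgf o t w)%:E)%E.
  by rewrite lee_fin; case: o => [k|] /=; rewrite ?expR_ge0.
have mg o : measurable_fun setT (EFin \o selected_mgf o t).
  apply/measurable_EFinP.
  apply: (@measurable_fun_coarser _ _ (past_rectangles U X t.+1)).
    exact: past_rectangles_measurable.
  exact: measurable_selected_mgf.
have -> : (\int[P]_w (selected_exp t.+1 w)%:E =
    \sum_o \int[P]_w ((Y o w)%:E * (selected_mgf o t w)%:E))%E.
  rewrite -ge0_integral_sum//=; last 2 first.
  - by move=> o; apply: emeasurable_funM; [exact: mY'|exact: mg].
  - by move=> o w _; rewrite mule_ge0.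
  apply: eq_integral => w _; rewrite /selected_exp big_ord_recr/=.
  rewrite -(sel_indic_sum (fun o => selected_exp t w * selected_mgf o t w)).
  by rewrite sumEFin; congr EFin; apply: eq_bigr => o _; rewrite mulrA.
have -> : (\int[P]_w (selected_exp t w)%:E = \sum_o \int[P]_w (Y o w)%:E)%E.
  rewrite -ge0_integral_sum//=.
  apply: eq_integral => w _; rewrite sumEFin.
  by rewrite (sel_indic_sum (fun=> selected_exp t w)).
(* Without a selected arm the factor of round [t] is 1; otherwise independence factors the
   integral. *)
apply: lee_sum => -[k|] _ /=; last by under eq_integral do rewrite mule1.
rewrite (@integral_independent _ _ _ P _ _ (past_rectangles U X t) (X k t)
  sub (past_rectanglesT _ _ _) (@past_rectanglesI _ _ _ _ P _ _ U X t) _ _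
  (EFin \o Y (Some k))
  (fun x => (expR (lambda * (x - mu k) - lambda ^+ 2 / 8))%:E))//.
- rewrite -[leRHS]mule1; apply: lee_wpmul2l; last exact: mgf.
  by apply: integral_ge0 => w _; exact: Y0.
- move=> E B; exact: (past_independent indepUX).
- by move=> w; exact: Y0.
- apply/measurable_EFinP; apply: measurableT_comp => //; apply: measurable_funB => //.
  by apply: measurable_funM => //; apply: measurable_funB.
Qed.

End exponential_supermartingale.

(** * Measurability of the interaction *)

Section discrete_measurability.
Variables (d : measure_display) (T : measurableType d).

(** For countable [D] this is measurability for the discrete sigma-algebra, stated on singletons so
    that sets and lists of arms need no measurable structure. *)
Definition discretely_measurable (D : Type) (f : T -> D) :=
  forall a, measurable (f @^-1` [set a]).

Lemma discretely_measurable_cst (D : Type) (a : D) :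
  discretely_measurable (fun=> a).
Proof.
move=> b; have [<-|neq] := pselect (a = b).
  by rewrite [X in measurable X](_ : _ = setT)//; apply/seteqP; split.
by rewrite [X in measurable X](_ : _ = set0)//; apply/seteqP; split.
Qed.

(** The preimage is a countable union over the values [a] of [f]. Only attained values are
    constrained, so that the length of the list of pulled arms is known when this is applied to
    it. *)
Lemma discretely_measurable_bind (D : countType) (D' : Type) (f : T -> D)
    (g : D -> T -> D') :
  discretely_measurable f ->
  (forall w, discretely_measurable (g (f w))) ->
  discretely_measurable (fun w => g (f w) w).
Proof.
move=> mf mg b.
rewrite [X in measurable X](_ : _ =
    \bigcup_a ((f @^-1` [set a]) `&` (g a @^-1` [set b]))); last first.
  apply/seteqP; split=> w /=; first by move=> gb; exists (f w).
  by move=> [a _ /= [-> ->]].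
apply: countable_bigcupT_measurable => // a.
have [[w <-]|no] := pselect (exists w, f w = a).
  by apply: measurableI; [exact: mf|exact: mg].
rewrite [X in measurable X](_ : _ = set0)//.
by apply/seteqP; split=> // w /= [fa _]; apply: no; exists w.
Qed.

Lemma discretely_measurable_comp (D : countType) (D' : Type) (f : T -> D)
    (h : D -> D') : discretely_measurable f ->
  discretely_measurable (fun w => h (f w)).
Proof.
move=> mf; apply: (discretely_measurable_bind (g := fun a _ => h a)) => // w.
exact: discretely_measurable_cst.
Qed.

Lemma discretely_measurable_set (I : finType) (F : T -> {set I}) :
  (forall k, measurable [set w | k \in F w]) -> discretely_measurable F.
Proof.
move=> mF A.
rewrite [X in measurable X](_ : _ = \bigcap_(k : I)
    (if k \in A then [set w | k \in F w] else ~` [set w | k \in F w])).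
  by apply: fin_bigcap_measurable => // k _; case: ifP => _ //; exact: measurableC.
apply/seteqP; split=> w /=.
  by move=> <- k _; case: ifPn => // /negP.
move=> h; apply/setP => k; have := h k Logic.I; case: ifPn => [_ -> //|_ /negP/negbTE //].
Qed.

Lemma measurable_ler_set (R : realType) (f g : T -> R) : measurable_fun setT f ->
  measurable_fun setT g -> measurable [set w | f w <= g w].
Proof.
move=> mf mg.
have := measurable_fun_ler mf mg measurableT (Y := [set true]).
by rewrite setTI; apply.
Qed.

Lemma measurable_bigmaxr (R : realType) (I : Type) (s : seq I) (A : pred I)
    (v : T -> R) (F : I -> T -> R) :
  measurable_fun setT v -> (forall i, measurable_fun setT (F i)) ->
  measurable_fun setT (fun w => \big[Num.max/v w]_(i <- s | A i) F i w).
Proof.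
move=> mv mF; elim: s => [|i s IH].
  by under eq_fun do rewrite big_nil.
under eq_fun do rewrite big_cons; case: (A i) => //.
exact: measurable_maxr.
Qed.

End discrete_measurability.
Arguments discretely_measurable_comp {d T D D' f} h _.

Section measurability_of_play.
Variables (R : realType) (K : nat) (k0 : 'I_K) (C : R) (T : nat) (delta B : R).
Variables (d : measure_display) (Omega : measurableType d).
Variables (dW : measure_display) (W : measurableType dW).
Variables (adv : attack_policy R K W) (hadv : measurable_attack adv).

Let alg := SE_WR_Stop k0 C T delta B.
Let update := @se_update R K C T delta B.

Lemma measurable_se_eliminate (S : {set 'I_K}) n (m : 'I_K -> Omega -> R) i :
  (forall k, measurable_fun setT (m k)) ->
  discretely_measurable
    (fun w => se_eliminate C T delta S n (fun k => m k w) i).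
Proof.
move=> mm; apply: discretely_measurable_set => k.
rewrite [X in measurable X](_ : _ = if k \in S then
  [set w | \big[Num.max/m i w]_(k in S) m k w - 2 * se_width K C T delta n <= m k w]
  else set0).
  case: ifP => // _; apply: measurable_ler_set => //.
  by apply: measurable_funB => //; exact: measurable_bigmaxr.
by apply/seteqP; split=> w /=; rewrite inE; case: (k \in S).
Qed.

(** The part of the state with countably many values; the real totals are treated apart. *)
Definition se_discrete (st : se_state R K) : {set 'I_K} * nat * seq 'I_K :=
  (active st, npulls st, queue st).

Definition measurable_se_state (st : Omega -> se_state R K) :=
  (forall k, measurable_fun setT (fun w => Defs.total (st w) k)) /\
  discretely_measurable (fun w => se_discrete (st w)).

Lemma measurable_se_update st i (y : Omega -> R) :
  measurable_se_state st -> measurable_fun setT y ->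
  measurable_se_state (fun w => update (st w) (i, y w)).
Proof.
move=> [mtot mdisc] my.
pose tot k w := if k == i then Defs.total (st w) k + y w else Defs.total (st w) k.
have mtot' k : measurable_fun setT (tot k).
  by rewrite /tot; case: eqP => _ //; exact: measurable_funD.
split.
  move=> k; rewrite [X in measurable_fun _ X](_ : _ = tot k)//.
  apply/funext => w; rewrite /update /se_update.
  by case: (behead _) => //; case: ifP.
(* For a fixed discrete part, the next one depends on the totals only through the elimination. *)
pose g (D : {set 'I_K} * nat * seq 'I_K) w :=
  let: (S0, n, q) := D in
  if behead q is j :: q' then (S0, n, j :: q')
  else if n%:R <= B then
    let S' := se_eliminate C T delta S0 n.+1 (fun k => tot k w / n.+1%:R) i in
    (S', n.+1, enum S')
  else (S0, n, enum S0).
rewrite (_ : (fun w => _) = (fun w => g (se_discrete (st w)) w)); last first.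
  apply/funext => w; rewrite /update /se_update /g /se_discrete.
  by case: (behead _) => //; case: ifP.
apply: discretely_measurable_bind => // w.
case: (se_discrete (st w)) => -[S0 n] q; rewrite /g.
case: (behead q) => [|j q']; last exact: discretely_measurable_cst.
case: (n%:R <= B); last exact: discretely_measurable_cst.
have mS : discretely_measurable (fun w =>
    se_eliminate C T delta S0 n.+1 (fun k => tot k w / n.+1%:R) i).
  by apply: measurable_se_eliminate => k; apply: measurable_funM.
exact: (discretely_measurable_comp
  (fun A : {set 'I_K} => (A, n.+1, enum A)) mS).
Qed.

Variables (Uf : Omega -> W) (Xf : 'I_K -> nat -> Omega -> R) (s : nat).
Hypothesis mU : measurable_fun setT Uf.
Hypothesis mX : forall k t, (t < s)%N -> measurable_fun setT (Xf k t).

(* The history produced when the arms in the list (latest first) are pulled,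
   whatever the learner would do: the adversary is only assumed measurable for
   fixed arms. *)
Fixpoint forced_play (a : seq 'I_K) (w : Omega) : history R K :=
  if a is i :: a' then
    let h := forced_play a' w in
    let x := Xf i (size a') w in
    rcons h (i, (x, adv (Uf w) h i x))
  else [::].

(** The tuple of rewards is needed because the attack is measurable as a function of such a tuple
    along fixed arms. The list runs backwards, hence [rev a]. *)
Lemma measurable_forced_play (a : seq 'I_K) : (size a <= s)%N ->
  (exists2 r : Omega -> (size a).-tuple (R * R), measurable_fun setT r &
    forall w, forced_play a w = zip (rev a) (r w)) /\
  measurable_se_state
    (fun w => foldl update (se_init R K) (observed (forced_play a w))).
Proof.
elim: a => [_|i a IH sa].
  split; first by exists (fun=> [tuple]).
  by split=> /= [k|]; [exact: measurable_cst|exact: discretely_measurable_cst].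
have [[r mr er] mst] := IH (ltnW sa).
have mXi := mX i sa.
pose y w := adv (Uf w) (forced_play a w) i (Xf i (size a) w).
have my : measurable_fun setT y.
  rewrite (_ : y = (fun p : W * (size a).-tuple (R * R) * R =>
      adv p.1.1 (zip (rev_tuple (in_tuple a)) p.1.2) i p.2) \o
      (fun w => (Uf w, r w, Xf i (size a) w))); last first.
    by apply/funext => w; rewrite /y er.
  apply: measurableT_comp; first exact: hadv.
  by apply/measurable_fun_pairP; split => //; apply/measurable_fun_pairP; split.
split; last first.
  rewrite (_ : (fun w => _) = (fun w =>
    update (foldl update (se_init R K) (observed (forced_play a w))) (i, y w))).
    exact: measurable_se_update.
  by apply/funext => w; rewrite /= /observed map_rcons foldl_rcons.
exists (fun w => [tuple of rcons (r w) (Xf i (size a) w, y w)]).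
  apply/measurable_fun_tnthP => j.
  (* Taking the new entry as the default of [nth] covers the last coordinate as well as the old
     ones. *)
  rewrite (_ : _ \o _ = fun w => nth (Xf i (size a) w, y w) (r w) j); last first.
    apply/funext => w /=.
    rewrite (tnth_nth (Xf i (size a) w, y w))/= nth_rcons size_tuple.
    case: ltngtP => // [ja|->]; last by rewrite nth_default// size_tuple.
    by have := leq_trans (ltn_ord j) ja; rewrite ltnn.
  have [ja|ja] := ltnP j (size a).
    rewrite (_ : (fun w => _) = (fun w => tnth (r w) (Ordinal ja))).
      exact: (proj1 (measurable_fun_tnthP r) mr (Ordinal ja)).
    by apply/funext => w; rewrite (tnth_nth (Xf i (size a) w, y w)).
  rewrite (_ : (fun w => _) = (fun w => (Xf i (size a) w, y w))).
    by apply/measurable_fun_pairP; split.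
  by apply/funext => w; rewrite nth_default// size_tuple.
move=> w /=.
by rewrite rev_cons zip_rcons ?size_rev ?size_tuple// -er.
Qed.

Let plays t w := play alg (adv (Uf w)) (fun k t => Xf k t w) t.
Let arms t w := rev [seq e.1 | e <- plays t w].

(** The true run is the forced run along its own arms; splitting by the countably many lists of arms
    thus reduces its measurability to that of forced runs. *)
Let plays_forced t w : plays t w = forced_play (arms t w) w /\ size (arms t w) = t.
Proof.
elim: t => // t [IH st]; rewrite /arms /plays/= map_rcons rev_rcons/=.
rewrite -/(plays t w) -/(arms t w) size_rev size_map.
have -> : size (plays t w) = t by move: st; rewrite /arms size_rev size_map.
by rewrite -IH; split.
Qed.

Let next (a : seq 'I_K) w := alg (observed (forced_play a w)).

Let measurable_next t w : (t <= s)%N -> discretely_measurable (next (arms t w)).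
Proof.
rewrite -{1}(plays_forced t w).2 => /measurable_forced_play [_ [_ mdisc]].
exact: (discretely_measurable_comp (fun D => head k0 D.2) mdisc).
Qed.

Let measurable_arms t : (t <= s)%N -> discretely_measurable (arms t).
Proof.
elim: t => [_|t IH ts]; first exact: discretely_measurable_cst.
rewrite (_ : arms t.+1 = (fun w => next (arms t w) w :: arms t w)); last first.
  apply/funext => w; rewrite {1}/arms /plays/= map_rcons rev_rcons/=.
  by rewrite /next -(plays_forced t w).1.
apply: (discretely_measurable_bind (g := fun a w => next a w :: a)).
  exact/IH/ltnW.
move=> w; apply: (discretely_measurable_comp (fun i => i :: arms t w)).
exact/measurable_next/ltnW.
Qed.

Lemma measurable_pulled t : (t <= s)%N ->
  discretely_measurable (fun w => pulled alg (adv (Uf w)) (fun k t => Xf k t w) t).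
Proof.
move=> ts; rewrite (_ : (fun w => _) = (fun w => next (arms t w) w)); last first.
  by apply/funext => w; rewrite /next -(plays_forced t w).1.
apply: discretely_measurable_bind; first exact: measurable_arms.
by move=> w; exact: measurable_next.
Qed.

End measurability_of_play.

(** * Deterministic regret analysis *)

Section deterministic_analysis.
Variables (R : realType) (K : nat) (k0 : 'I_K) (C : R) (T : nat) (delta B : R).
Variables (adv : history R K -> 'I_K -> R -> R) (x : 'I_K -> nat -> R).
Variables (mu : 'I_K -> R) (best : 'I_K) (D : R).

Let alg := SE_WR_Stop k0 C T delta B.
Let update := @se_update R K C T delta B.
Let plays := play alg adv x.
Let state t := foldl update (se_init R K) (observed (plays t)).
Let arm := pulled alg adv x.
Let attacked t := adv (plays t) (arm t) (x (arm t) t).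
Let l : R := ln (2 * K%:R * T%:R / delta).
Let width := @se_width R K C T delta.

Definition pull_count (k : 'I_K) (t : nat) : nat := \sum_(s < t) (arm s == k).

Definition arm_deviation (k : 'I_K) (t : nat) : R :=
  \sum_(s < t) (if arm s == k then x k s - mu k else 0).

Let gap k := mu best - mu k.

Hypothesis C_ge0 : 0 <= C.
Hypothesis B_ge0 : 0 <= B.
Hypothesis mu01 : forall k, 0 <= mu k <= 1.
Hypothesis best_max : forall k, mu k <= mu best.
Hypothesis attack_le : total_attack alg adv x T <= C.
Hypothesis concentration : forall k t, (t <= T)%N ->
  `|arm_deviation k t| <= Num.sqrt (l * (pull_count k t)%:R).
Hypothesis l_ge : 4^-1 <= l.
Hypothesis D_ge0 : 0 <= D.
Hypothesis final_width : forall n : nat, B < n%:R -> 4 * width n <= D.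

Let l_ge0 : 0 <= l. Proof. by apply: le_trans l_ge; rewrite invr_ge0. Qed.

Let stateS t : state t.+1 = update (state t) (arm t, attacked t).
Proof. by rewrite /state /plays /= /observed map_rcons foldl_rcons. Qed.

Let armE t : arm t = head k0 (queue (state t)).
Proof. by []. Qed.

Let total_stateS t k : Defs.total (state t.+1) k =
  Defs.total (state t) k + (if arm t == k then attacked t else 0).
Proof.
rewrite stateS /update /se_update eq_sym.
by case: (behead _) => [|j q]; [case: ifP => _|] => /=; case: ifP; rewrite ?addr0.
Qed.

Let total_state t k :
  Defs.total (state t) k = \sum_(s < t) (if arm s == k then attacked s else 0).
Proof.
elim: t => [|t IH]; first by rewrite big_ord0.
by rewrite big_ord_recr total_stateS IH.
Qed.

Let attack_sum t :
  total_attack alg adv x t = \sum_(s < t) `|x (arm s) s - attacked s|.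
Proof.
elim: t => [|t IH]; first by rewrite /total_attack big_nil big_ord0.
by rewrite big_ord_recr/= -IH /total_attack/= -cats1 big_cat big_seq1.
Qed.

Let attack_le_prefix t : (t <= T)%N -> total_attack alg adv x t <= C.
Proof.
move=> tT; apply: le_trans attack_le; rewrite !attack_sum.
rewrite (big_ord_widen T (fun s => `|x (arm s) s - attacked s|) tT).
by rewrite [leRHS](bigID (fun s : 'I_T => s < t)%N)/= lerDl sumr_ge0.
Qed.

(** The root accounts for the raw rewards; the attack on arm [k] alone is at most the total attack,
    hence at most [C]. *)
Let total_close t k : (t <= T)%N ->
  `|Defs.total (state t) k - (pull_count k t)%:R * mu k| <=
  Num.sqrt (l * (pull_count k t)%:R) + C.
Proof.
move=> tT.
have -> : Defs.total (state t) k - (pull_count k t)%:R * mu k = arm_deviation k t -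
    \sum_(s < t) (if arm s == k then x (arm s) s - attacked s else 0).
  rewrite total_state /arm_deviation /pull_count natr_sum mulr_suml -!sumrB.
  apply: eq_bigr => s _; case: eqP => [<-|_] /=; [ring|].
  by rewrite mul0r subrr.
apply: le_trans (ler_normB _ _) _; apply: lerD; first exact: concentration.
apply: le_trans (attack_le_prefix tT); rewrite attack_sum.
apply: le_trans (ler_norm_sum _ _ _) _; apply: ler_sum => s _.
by case: ifP; rewrite ?normr0.
Qed.

Let widthE (n : nat) : (0 < n)%N -> width n = (Num.sqrt (l * n%:R) + C) / n%:R.
Proof.
move=> n0; have nR : 0 < n%:R :> R by rewrite ltr0n.
rewrite /width /se_width -/l mulrDl; congr (_ + _).
have -> : l / n%:R = l * n%:R * n%:R^-1 ^+ 2 by field; exact: lt0r_neq0.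
by rewrite sqrtrM ?mulr_ge0 ?l_ge0// sqrtr_sqr ger0_norm// invr_ge0 ltW.
Qed.

Let mean_close t k (n := pull_count k t) : (t <= T)%N -> (0 < n)%N ->
  `|Defs.total (state t) k / n%:R - mu k| <= width n.
Proof.
move=> tT n0.
have nR : 0 < n%:R :> R by rewrite ltr0n.
have -> : Defs.total (state t) k / n%:R - mu k =
    (Defs.total (state t) k - n%:R * mu k) / n%:R.
  by field; exact: lt0r_neq0.
rewrite normrM (gtr0_norm (_ : 0 < n%:R^-1)) ?invr_gt0//.
rewrite widthE//.
by rewrite ler_pM2r ?invr_gt0//; exact: total_close.
Qed.

Let pull_countS k t : pull_count k t.+1 = (pull_count k t + (arm t == k))%N.
Proof. by rewrite /pull_count big_ord_recr. Qed.

(** While the loop runs, [npulls] counts the completed sweeps, and an active arm outside the queue,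
    already pulled in the current sweep, has one more pull. After the loop [npulls] is frozen and
    [inv_count] claims nothing; [inv_gap] persists because the active set is frozen too. *)
Record se_invariant (t : nat) (st : se_state R K) : Prop := SeInvariant {
  inv_queue : queue st != [::];
  inv_uniq : uniq (queue st);
  inv_sub : {subset queue st <= active st};
  inv_count : (npulls st)%:R <= B -> forall k, k \in active st ->
    pull_count k t = (npulls st + (k \notin queue st))%N;
  inv_best : best \in active st;
  inv_gap : (0 < npulls st)%N -> forall k, k \in active st ->
    gap k <= 4 * width (npulls st) }.

Let enum_neq_nil (A : {set 'I_K}) a : a \in A -> enum A != [::].
Proof. by rewrite -mem_enum; case: (enum A). Qed.

(** At the end of a loop sweep all active arms have the same count and empirical means accurate to
    within w. Hence the maximum exceeds the estimate of the best arm by at most 2w, so that arm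
    survives; a survivor's estimate is at most 2w below that of the best arm, so its gap is at most
    4w. *)
Let invariant t : (t <= T)%N -> se_invariant t (state t).
Proof.
elim: t => [_|t IH tT].
  have in_queue k : k \in queue (se_init R K).
    by rewrite mem_enum; apply: mem_set.
  split=> /=.
  - by move: (in_queue best) => /=; case: (enum _).
  - exact: enum_uniq.
  - by move=> k _; rewrite inE.
  - by move=> _ k _; rewrite /pull_count big_ord0 in_queue.
  - by rewrite inE.
  - by [].
have [q0 qu qs qc ba ga] := IH (ltnW tT).
have close k : (0 < pull_count k t.+1)%N -> _ := @mean_close t.+1 k tT.
move: close q0 qu qs qc ba ga (armE t); rewrite stateS /update /se_update.
case: (state t) => S n tt [|i q] //= close _ /andP[iq qu] qs qc ba ga armt.
rewrite armt in close *.
(* A further arm [j] in the queue means that the sweep goes on, with [active] and [npulls]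
   unchanged. *)
case: q iq qu qs qc close => [|j q] iq qu qs qc close; last first.
  split=> //=.
    by move=> k kq; apply: qs; rewrite in_cons kq orbT.
  move=> nB k kS; rewrite pull_countS qc// armt !in_cons negb_or.
  have [->|ki] := eqVneq k i; last by rewrite /= addn0.
  by move: iq; rewrite in_cons negb_or => -> /=; rewrite addn0.
have cntS k : (n%:R <= B) -> k \in S -> pull_count k t.+1 = n.+1.
  move=> nB kS; rewrite pull_countS qc// armt in_cons in_nil orbF eq_sym.
  by case: eqP => _; rewrite ?addn0 addn1.
case: ifP => nB; last first.
  split=> //=.
  - exact: enum_neq_nil ba.
  - exact: enum_uniq.
  - by move=> k; rewrite mem_enum.
  - by rewrite nB.
rewrite nB /= in close.
pose m k := if k == i then tt k + attacked t else tt k.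
have iS : i \in S by apply: qs; rewrite mem_head.
set w := width n.+1.
have hat k : k \in S -> mu k - w <= m k / n.+1%:R <= mu k + w.
  by move=> kS; have := close k; rewrite -/(m k) cntS// ler_distl => /(_ isT).
pose S' := se_eliminate C T delta S n.+1 (fun j => m j / n.+1%:R) i; rewrite -/S'.
have S'E k : k \in S' -> k \in S /\ m best / n.+1%:R - 2 * w <= m k / n.+1%:R.
  rewrite inE => /andP[kS b]; split=> //; apply: le_trans b.
  by rewrite lerD2r; apply: (bigmax_sup best).
have bS' : best \in S'.
  rewrite inE ba/= -/(width n.+1) -/w.
  set mx := \big[_/_]_(_ in _) _.
  have : mx <= mu best + w.
    by apply: bigmax_le => [|k kS]; rewrite (le_trans (proj2 (andP (hat _ _))))// lerD2r.
  have /andP[h1 _] := hat _ ba => h3.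
  by apply: le_trans h1; rewrite lerBlDr (le_trans h3)//; lra.
split=> //=.
- exact: enum_neq_nil bS'.
- exact: enum_uniq.
- by move=> k; rewrite mem_enum.
- move=> _ k kS'; rewrite mem_enum kS' addn0.
  by apply: cntS => //; case: (S'E k kS').
- move=> _ k /S'E[kS h]; have /andP[h1 h2] := hat _ ba; have /andP[h3 h4] := hat _ kS.
  rewrite -/(width n.+1) -/w /gap.
  by move: (m best / _) (m k / _) h h1 h2 h3 h4 => a b *; lra.
Qed.

(* Rounds of the elimination loop, as opposed to those of the final
   round-robin, in which [npulls] no longer counts the pulls. *)
Let loop t : bool := (npulls (state t))%:R <= B.

Let loop_count (k : 'I_K) (t : nat) : nat := \sum_(s < t) ((arm s == k) && loop s).

Let loop_count_le k t : (loop_count k t <= pull_count k t)%N.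
Proof. by apply: leq_sum => s _; case: (arm s == k) => //; case: loop. Qed.

Let arm_in_queue t : (t <= T)%N -> arm t \in queue (state t).
Proof.
move=> /invariant[q0 _ _ _ _ _]; rewrite armE.
by case: (queue _) q0 => //= *; exact: mem_head.
Qed.

Let gap_ge0 k : 0 <= gap k.
Proof. by rewrite subr_ge0. Qed.

Let gap_le1 k : gap k <= 1.
Proof. by have /andP[h _] := mu01 k; have /andP[_ h1] := mu01 best; rewrite /gap; lra. Qed.

(** The factor 6 is 4 from the gap bound plus 2 to pay for one more pull. *)
Let bound n := 6 * Num.sqrt (l * n%:R) + 4 * C.

Let bound_homo m n : (m <= n)%N -> bound m <= bound n.
Proof.
move=> mn; rewrite lerD2r ler_pM2l// ler_wsqrtr// ler_wpM2l//.
by rewrite ler_nat.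
Qed.

(** The arm survived n sweeps, so its first n pulls cost at most 4 sqrt (l n) + 4 C; the pull of
    round [t] costs at most 1, which is at most 2 sqrt (l (n + 1)) because l >= 1/4. *)
Let loop_pull_gap t : (t < T)%N -> loop t ->
  (pull_count (arm t) t.+1)%:R * gap (arm t) <= bound (pull_count (arm t) t.+1).
Proof.
move=> tT lt; have qa := arm_in_queue (ltnW tT).
have [_ _ qs qc _ ga] := invariant (ltnW tT).
have kS := qs _ qa; have := qc lt _ kS; rewrite qa addn0 => cn.
rewrite pull_countS eqxx addn1 cn; move: (npulls _) ga => n ga.
have sq1 : 1 <= 2 * Num.sqrt (l * n.+1%:R).
  have : 2^-1 <= Num.sqrt (l * n.+1%:R); last by move=> h; lra.
  rewrite -[2^-1]ger0_norm ?invr_ge0// -sqrtr_sqr ler_wsqrtr//.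
  have -> : 2^-1 ^+ 2 = 4^-1 :> R by field.
  by apply: (le_trans l_ge); rewrite ler_peMr ?ler1n.
have sqn : Num.sqrt (l * n%:R) <= Num.sqrt (l * n.+1%:R).
  by rewrite ler_wsqrtr// ler_wpM2l// ler_nat.
have -> : n.+1%:R * gap (arm t) = n%:R * gap (arm t) + gap (arm t).
  by rewrite -natr1 mulrDl mul1r.
rewrite /bound.
suff : n%:R * gap (arm t) <= 4 * Num.sqrt (l * n%:R) + 4 * C.
  by move=> h; have h1 := gap_le1 (arm t); lra.
case: n ga {sq1 sqn} => [|n] ga; first by rewrite mul0r addr_ge0 ?mulr_ge0// sqrtr_ge0.
have := ga isT _ kS; rewrite -(ler_pM2l (_ : 0 < n.+1%:R))//.
move=> /le_trans; apply; rewrite widthE// le_eqVlt; apply/orP; left; apply/eqP.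
have nz : n.+1%:R != 0 :> R by rewrite pnatr_eq0.
by move: (n.+1%:R) (Num.sqrt _) nz => a b nz; field.
Qed.

(** A loop pull of [k] renews the bound; in any other round the left side is unchanged and the right
    side does not decrease. *)
Let loop_bound k t : (t <= T)%N -> (loop_count k t)%:R * gap k <= bound (pull_count k t).
Proof.
elim: t => [_|t IH tT].
  by rewrite /loop_count big_ord0 mul0r addr_ge0 ?mulr_ge0// sqrtr_ge0.
have step : loop_count k t.+1 = (loop_count k t + ((arm t == k) && loop t))%N.
  by rewrite /loop_count big_ord_recr.
case: (boolP ((arm t == k) && loop t)) => [/andP[/eqP <- lt]|nl].
  apply: le_trans (loop_pull_gap tT lt).
  by rewrite ler_wpM2r// ler_nat loop_count_le.
rewrite step (negbTE nl) addn0; apply: le_trans (IH (ltnW tT)) _.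
by apply: bound_homo; rewrite pull_countS leq_addr.
Qed.

Let sum_pull_count t : (\sum_k pull_count k t)%N = t.
Proof.
rewrite /pull_count exchange_big/= -[RHS]card_ord -sum1_card; apply: eq_bigr => s _.
by rewrite (bigD1 (arm s))//= eqxx big1 ?addn0// => k /negbTE; rewrite eq_sym => ->.
Qed.

Hypothesis T_gt0 : (0 < T)%N.

Let K_gt0 : (0 < K)%N. Proof. exact: leq_trans (ltn_ord k0). Qed.

(* Cauchy-Schwarz, as a sum of 2 q a <= q^2 + a^2 for the common optimal q. *)
Let sum_sqrt_pull_count :
  \sum_k Num.sqrt (l * (pull_count k T)%:R) <= Num.sqrt (l * K%:R * T%:R).
Proof.
set q := Num.sqrt (l * T%:R / K%:R).
have l_gt0 : 0 < l by apply: lt_le_trans l_ge; rewrite invr_gt0.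
have KR : 0 < K%:R :> R by rewrite ltr0n.
have TR : 0 < T%:R :> R by rewrite ltr0n.
have q_gt0 : 0 < q by rewrite sqrtr_gt0 divr_gt0// mulr_gt0.
have q2 : q ^+ 2 = l * T%:R / K%:R by rewrite sqr_sqrtr// ltW// divr_gt0// mulr_gt0.
have -> : Num.sqrt (l * K%:R * T%:R) = K%:R * q.
  have -> : l * K%:R * T%:R = K%:R ^+ 2 * (l * T%:R / K%:R).
    by field; exact: lt0r_neq0.
  by rewrite sqrtrM ?sqr_ge0// sqrtr_sqr gtr0_norm.
rewrite -(ler_pM2l (_ : 0 < 2 * q)) ?mulr_gt0// mulr_sumr.
apply: (@le_trans _ _ (\sum_k (q ^+ 2 + l * (pull_count k T)%:R))).
  apply: ler_sum => k _.
  rewrite -[X in _ <= _ + X](sqr_sqrtr (_ : 0 <= l * _)) ?mulr_ge0//.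
  by have := sqr_ge0 (q - Num.sqrt (l * (pull_count k T)%:R)); nra.
rewrite big_split/= sumr_const card_ord -mulr_sumr -natr_sum sum_pull_count.
rewrite -[q ^+ 2 *+ K]mulr_natr.
have -> : l * T%:R = K%:R * q ^+ 2 by rewrite q2; field; exact: lt0r_neq0.
by rewrite le_eqVlt; apply/orP; left; apply/eqP; ring.
Qed.

(** Loop rounds are grouped by arm and summed by Cauchy-Schwarz; each later round costs at most [D],
    since its arm is active and [npulls] exceeds [B]. *)
Lemma pseudo_regret_le : \sum_(t < T) (mu best - mu (arm t)) <=
  6 * Num.sqrt (l * K%:R * T%:R) + 4 * K%:R * C + T%:R * D.
Proof.
apply: (@le_trans _ _ (\sum_(t < T) (\sum_k ((arm t == k) && loop t)%:R * gap k + D))).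
  apply: ler_sum => t _; rewrite (bigD1 (arm t))//= eqxx/= big1 ?addr0; last first.
    by move=> k /negbTE; rewrite eq_sym => ->; rewrite mul0r.
  case: (boolP (loop t)) => lt; first by rewrite mul1r lerDl.
  rewrite mul0r add0r; have tT := ltn_ord t.
  have [_ _ qs _ _ ga] := invariant (ltnW tT).
  rewrite -ltNge in lt.
  apply: le_trans (final_width lt); apply: ga; last exact/qs/arm_in_queue/ltnW.
  (* As B >= 0, [npulls] is positive, which [inv_gap] requires. *)
  by rewrite -(ltr0n R); apply: le_lt_trans lt.
rewrite big_split/= sumr_const card_ord -[D *+ T]mulr_natl lerD2r exchange_big/=.
apply: (@le_trans _ _ (\sum_k bound (pull_count k T))).
  apply: ler_sum => k _; apply: le_trans (loop_bound k (leqnn T)).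
  by rewrite -mulr_suml natr_sum.
rewrite /bound big_split/= sumr_const card_ord -mulr_sumr lerD//.
  by rewrite ler_pM2l.
by rewrite -[4 * C *+ K]mulr_natl mulrCA mulrA.
Qed.

Lemma pseudo_regret_le_horizon : \sum_(t < T) (mu best - mu (arm t)) <= T%:R.
Proof.
rewrite -[leRHS]mulr1 mulr_natl -[X in 1 *+ X]card_ord -sumr_const.
by apply: ler_sum => t _; exact: gap_le1.
Qed.

Hypothesis reward_dev : forall k,
  \sum_(t < T) (x k t - mu k) <= Num.sqrt (l * T%:R).
Hypothesis pulled_dev :
  - Num.sqrt (l * T%:R) <= \sum_(t < T) (x (arm t) t - mu (arm t)).

(** Against a fixed arm, the realized regret is the deviation of that arm, minus the deviation of
    the pulled arms, plus a difference of means, which is largest for [best]. *)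
Lemma regret_le_pseudo_regret : regret alg adv x k0 T <=
  \sum_(t < T) (mu best - mu (arm t)) + 2 * Num.sqrt (l * T%:R).
Proof.
have H k : \sum_(0 <= t < T) (x k t - x (arm t) t) <=
    \sum_(t < T) (mu best - mu (arm t)) + 2 * Num.sqrt (l * T%:R).
  rewrite big_mkord.
  have -> : \sum_(t < T) (x k t - x (arm t) t) = \sum_(t < T) (x k t - mu k)
     - \sum_(t < T) (x (arm t) t - mu (arm t)) + \sum_(t < T) (mu k - mu (arm t)).
    by rewrite -sumrB -big_split/=; apply: eq_bigr => t _; ring.
  have : \sum_(t < T) (mu k - mu (arm t)) <= \sum_(t < T) (mu best - mu (arm t)).
    by apply: ler_sum => t _; rewrite lerD2r.
  by move=> h; have h1 := reward_dev k; have h2 := pulled_dev; lra.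
by rewrite /regret; apply: bigmax_le => [|k _]; exact: H.
Qed.

End deterministic_analysis.

(** * Regret with high probability *)

Lemma selected_expE (R : realType) (K : nat) (d : measure_display)
    (Omega : measurableType d) (P : probability Omega R)
    (X : 'I_K -> nat -> {RV P >-> R}) (mu : 'I_K -> R) (lambda : R)
    (sel : nat -> Omega -> option 'I_K) (t : nat) (w : Omega) :
  selected_exp X mu lambda sel t w = expR
    (lambda * (\sum_(s < t) (if sel s w is Some k then X k s w - mu k else 0))
     - lambda ^+ 2 / 8 * (\sum_(s < t) (sel s w : bool))%:R).
Proof.
rewrite natr_sum !mulr_sumr -sumrB expR_sum; apply: eq_bigr => s _.
by case: (sel s w) => [k|] /=; rewrite ?mulr1// !mulr0 subrr expR0.
Qed.

(* [4 * sqrt (l / n)] is the optimal Chernoff parameter at level [2 * l]. *)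
Lemma chernoff_exponent (R : realType) (l n Z : R) : 0 < l -> 0 < n ->
  expR (4 * Num.sqrt (l / n) * Z - (4 * Num.sqrt (l / n)) ^+ 2 / 8 * n) <
    expR (2 * l) ->
  Z <= Num.sqrt (l * n).
Proof.
move=> l0 n0; rewrite ltr_expR exprMn sqr_sqrtr ?divr_ge0 ?(ltW l0) ?(ltW n0)//.
have -> : 4 ^+ 2 * (l / n) / 8 * n = 2 * l by field; exact: lt0r_neq0.
move=> h.
have q0 : 0 < Num.sqrt (l / n) by rewrite sqrtr_gt0 divr_gt0.
rewrite -(ler_pM2l q0).
have -> : Num.sqrt (l / n) * Num.sqrt (l * n) = l.
  rewrite -sqrtrM ?divr_ge0 ?(ltW l0) ?(ltW n0)//.
  have -> : l / n * (l * n) = l ^+ 2 by field; exact: lt0r_neq0.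
  by rewrite sqrtr_sqr gtr0_norm.
by move: (Num.sqrt _) h => q h; nra.
Qed.

Section high_probability.
Variables (R : realType) (K : nat) (hK : (2 <= K)%N) (T : nat).
Hypothesis hT : (1 <= T)%N.
Variables (nu : 'I_K -> probability R R).
Hypothesis hnu : bandit_instance nu.
Variables (d : measure_display) (Omega : measurableType d).
Variables (P : probability Omega R) (X : 'I_K -> nat -> {RV P >-> R}).
Hypothesis hX : rewards_distributed T nu X.
Variables (dW : measure_display) (W : measurableType dW).
Variables (U : {mfun Omega >-> W}).
Hypothesis hUX : independent_rounds T U X.
Variables (adv : attack_policy R K W).
Hypothesis hadv : measurable_attack adv.
Variables (C delta B : R).
Hypothesis hdelta : 0 < delta < 1.

Let k0 := arm0 hK.
Let alg := SE_WR_Stop k0 C T delta B.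
Let l : R := ln (2 * K%:R * T%:R / delta).
Let mu := arm_mean nu.
Let pull s w := pulled alg (adv (U w)) (fun k t => X k t w) s.

Let KR : 2 <= K%:R :> R. Proof. by rewrite ler_nat. Qed.
Let TR : 1 <= T%:R :> R. Proof. by rewrite ler1n. Qed.

Let arg_ge4 : 4 <= 2 * K%:R * T%:R / delta.
Proof.
have /andP[d0 d1] := hdelta.
by rewrite ler_pdivlMr//; move: (K%:R) (T%:R) KR TR => a b ha hb; nra.
Qed.

Let l_ge : 4^-1 <= l.
Proof.
rewrite /l -[4^-1]expRK ler_ln ?posrE ?expR_gt0//; last exact: lt_le_trans arg_ge4.
apply: le_trans arg_ge4; have h := expR_ge1Dx (- 4^-1 : R).
(* The bound exp (1/4) <= 4/3 comes from 1 - 1/4 <= exp (-1/4). *)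
have h1 : expR (4^-1 : R) <= (3 / 4)^-1.
  by rewrite -[4^-1]opprK expRN lef_pV2 ?posrE ?expR_gt0//; lra.
by lra.
Qed.

Let l_gt0 : 0 < l. Proof. by apply: lt_le_trans l_ge; rewrite invr_gt0. Qed.

Let expR_2l : expR (2 * l) = (2 * K%:R * T%:R / delta) ^+ 2.
Proof.
by rewrite -[2]/(2%:R) expRM_natl lnK// posrE; exact: lt_le_trans arg_ge4.
Qed.

Let mgf lambda k t : (t < T)%N ->
  (\int[P]_w (expR (lambda * (X k t w - mu k) - lambda ^+ 2 / 8))%:E <= 1)%E.
Proof.
move=> tT; apply: le_trans (hoeffding_mgf (hnu.1 k) lambda).
have mg : measurable_fun setT
    (fun x : R => (expR (lambda * (x - mu k) - lambda ^+ 2 / 8))%:E).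
  apply/measurable_EFinP; apply: measurableT_comp => //; apply: measurable_funB => //.
  by apply: measurable_funM => //; apply: measurable_funB.
rewrite -(ge0_integral_distribution (X k t) mg)//.
rewrite (eq_measure_integral (nu k))// => A mA _.
exact: hX.
Qed.

(** Measurability of the play is applied with [Omega] carrying only the sigma-algebra of the past:
    this is the predictability of the pulls. *)
Let measurable_past_pull t :
  @discretely_measurable _ (past U X t) _ (pull t).
Proof.
apply: (@measurable_pulled R K k0 C T delta B _ (past U X t) _ W adv hadv U X t) => //.
  exact: measurable_past_randomness.
by move=> k r; exact: measurable_past_reward.
Qed.

(* [inl (k, t, n, b)] tests the deviation, of sign b, of arm k after t.+1 rounds
   and n.+1 pulls; [inr (Some k)] the upper deviation of arm k over the horizon;
   [inr None] the lower deviation of the rewards of the pulled arms. *)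
Let test : finType := (('I_K * 'I_T * 'I_T * bool) + option 'I_K)%type.

Let test_time (j : test) : nat :=
  if j is inl (_, t, _, _) then t.+1 else T.

(** The optimal parameter depends on the number of pulls, which is random: each possible value gets
    its own test, used only on the runs where it is the true count. *)
Let test_lambda (j : test) : R :=
  match j with
  | inl (_, _, n, b) => (-1) ^+ b * (4 * Num.sqrt (l / n.+1%:R))
  | inr (Some _) => 4 * Num.sqrt (l / T%:R)
  | inr None => - (4 * Num.sqrt (l / T%:R))
  end.

Let test_sel (j : test) (s : nat) (w : Omega) : option 'I_K :=
  match j with
  | inl (k, _, _, _) => if pull s w == k then Some k else None
  | inr (Some k) => Some k
  | inr None => Some (pull s w)
  end.

Let test_exp j := selected_exp X mu (test_lambda j) (test_sel j) (test_time j).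

Let test_time_le j : (test_time j <= T)%N.
Proof. by case: j => [[[[k [t tT]] n] b]|o]. Qed.

Let measurable_test_sel j t o : (t < T)%N ->
  <<s past_rectangles U X t >> [set w | test_sel j t w = o].
Proof.
move=> _; case: j => [[[[k t'] n] b]|[k|]].
- exact: (discretely_measurable_comp
    (fun i : 'I_K => if i == k then Some k else None) (@measurable_past_pull t) o).
- exact: (@discretely_measurable_cst _ (past U X t) _ (Some k) o).
- exact: (discretely_measurable_comp (@Some 'I_K) (@measurable_past_pull t) o).
Qed.

Let total_exp w := \sum_j test_exp j w.

Let measurable_test_exp j : measurable_fun setT (test_exp j).
Proof.
apply: (measurable_selected_exp (T := T) (U := U)) => //.
by move=> t o; exact: measurable_test_sel.
Qed.

Let integral_total_exp : (\int[P]_w (total_exp w)%:E <= #|test|%:R%:E)%E.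
Proof.
under eq_integral do rewrite /total_exp -sumEFin.
rewrite ge0_integral_sum//; last 2 first.
- by move=> j; apply/measurable_EFinP.
- by move=> j w _; rewrite lee_fin selected_exp_ge0.
have -> : (#|test|%:R%:E = \sum_(j : test) 1 :> \bar R)%E.
  by rewrite sumEFin sumr_const.
apply: lee_sum => j _.
apply: (integral_selected_exp_le1 (T := T) (U := U)) => //.
- by move=> k t; exact: mgf.
- by move=> t o; exact: measurable_test_sel.
Qed.

Let bad := [set w | expR (2 * l) <= total_exp w].

Let total_exp_ge0 w : 0 <= total_exp w.
Proof. by apply: sumr_ge0 => j _; exact: selected_exp_ge0. Qed.

Let measurable_total_exp : measurable_fun setT total_exp.
Proof. by apply: measurable_sum => j. Qed.

Let measurable_bad : measurable bad.
Proof. exact: measurable_ler_set. Qed.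

(** By Markov's inequality at level (2KT/delta)^2 it suffices that the number 2KT^2 + K + 1 of tests
    is at most (2KT)^2 / delta. *)
Let prob_bad : (P bad <= delta%:E)%E.
Proof.
have /andP[d0 d1] := hdelta.
have e0 : 0 < expR (2 * l) by exact: expR_gt0.
have : ((expR (2 * l))%:E * P bad <= #|test|%:R%:E)%E.
  apply: le_trans integral_total_exp.
  pose Y : {RV P >-> R} := HB.pack total_exp
    (isMeasurableFun.Build _ _ _ _ _ measurable_total_exp).
  have := @markov _ _ _ P Y idfun _ e0 (@measurable_id _ _ _) (fun r r0 => r0)
    (fun a b _ _ ab => ab).
  rewrite (_ : [set w | _] = bad); last first.
    by apply/seteqP; split=> w; rewrite /bad/= lee_fin ger0_norm.
  move=> /le_trans; apply; rewrite unlock le_eqVlt; apply/orP; left; apply/eqP.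
  by apply: eq_integral => w _ /=; rewrite ger0_norm.
rewrite -(fineK (fin_num_measure P _ measurable_bad)) -EFinM !lee_fin.
rewrite mulrC -ler_pdivlMr// => /le_trans; apply.
rewrite ler_pdivrMr// expR_2l.
have -> : #|test| = (K * T * T * 2 + K.+1)%N.
  by rewrite card_sum !card_prod !card_ord card_bool card_option card_ord.
rewrite natrD !natrM -[K.+1%:R]natr1 expr_div_n.
have -> : delta * ((2 * K%:R * T%:R) ^+ 2 / delta ^+ 2) = (2 * K%:R * T%:R) ^+ 2 / delta.
  by field; exact: lt0r_neq0.
apply: (@le_trans _ _ ((2 * K%:R * T%:R) ^+ 2)).
  move: (K%:R) (T%:R) KR TR => a b ha hb.
  have h1 : 2 * a <= a * a by nra.
  have h2 : 1 <= b * b by nra.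
  have h3 : 2 * a * (b * b) <= a * a * (b * b) by nra.
  have h4 : a * a <= a * a * (b * b) by nra.
  have -> : (2 * a * b) ^+ 2 = 4 * (a * a * (b * b)) by ring.
  have -> : a * b * b * 2 + (a + 1) = 2 * a * (b * b) + (a + 1) by ring.
  by move: (2 * a * (b * b)) (a * a * (b * b)) (a * a) h1 h3 h4 => *; lra.
by rewrite ler_peMr ?sqr_ge0// invf_ge1// ltW.
Qed.

Let test_exp_small w j : ~ bad w -> test_exp j w < expR (2 * l).
Proof.
rewrite /bad/= => /negP; rewrite -ltNge; apply: le_lt_trans.
by rewrite /total_exp (bigD1 j)//= lerDl sumr_ge0// => i _; exact: selected_exp_ge0.
Qed.

Let good_concentration w k t : ~ bad w -> (t <= T)%N ->
  `|arm_deviation k0 C T delta B (adv (U w)) (fun k t => X k t w) mu k t| <=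
  Num.sqrt (l *
    (pull_count k0 C T delta B (adv (U w)) (fun k t => X k t w) k t)%:R).
Proof.
move=> good tT; set Z := arm_deviation _ _ _ _ _ _ _ _ _ _.
set n := pull_count _ _ _ _ _ _ _ _ _.
(* No test covers a count of 0, where the deviation is 0. Otherwise the test is indexed by [t.-1]
   and [n.-1], which are below [T]. *)
have [n0|n_gt0] := posnP n.
  suff -> : Z = 0 by rewrite normr0 sqrtr_ge0.
  rewrite /Z /arm_deviation big1// => s _; case: eqP => // e.
  have : (n <= 0)%N by rewrite n0.
  by rewrite /n /pull_count (bigD1 s)//= e eqxx.
have nt : (n <= t)%N.
  rewrite -[leqRHS]card_ord -sum1_card; apply: leq_sum => s _; exact: leq_b1.
have t_gt0 : (0 < t)%N := leq_trans n_gt0 nt.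
have tT' : (t.-1 < T)%N by rewrite prednK.
have nT' : (n.-1 < T)%N by rewrite prednK// (leq_trans nt).
have nR : 0 < n%:R :> R by rewrite ltr0n.
pose j b : test := inl (k, Ordinal tT', Ordinal nT', b).
have small b := test_exp_small (j b) good.
have value b : test_exp (j b) w =
    expR (4 * Num.sqrt (l / n%:R) * ((-1) ^+ b * Z)
          - (4 * Num.sqrt (l / n%:R)) ^+ 2 / 8 * n%:R).
  have eZ : \sum_(s < t) (if test_sel (j b) s w is Some i then X i s w - mu i
      else 0) = Z.
    by apply: eq_bigr => s _; rewrite /= /pull; case: eqP.
  have en : (\sum_(s < t) (test_sel (j b) s w : bool))%N = n.
    by apply: eq_bigr => s _; rewrite /= /pull; case: eqP.
  have et : test_time (j b) = t by rewrite /= prednK.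
  have el : test_lambda (j b) = (-1) ^+ b * (4 * Num.sqrt (l / n%:R)).
    by rewrite /= prednK.
  rewrite /test_exp selected_expE et eZ en el exprMn sqrr_sign mul1r.
  by rewrite -[_ * _ * Z]mulrA [_ * (_ * Z)]mulrCA.
rewrite ler_norml lerNl; apply/andP; split.
  by have := small true; rewrite value expr1 mulN1r => /(chernoff_exponent l_gt0 nR).
by have := small false; rewrite value expr0 mul1r => /(chernoff_exponent l_gt0 nR).
Qed.

Let count_all (sel : nat -> option 'I_K) : (forall s, sel s) ->
  (\sum_(s < T) (sel s : bool))%N = T.
Proof.
by move=> h; under eq_bigr do rewrite h; rewrite sum1_card card_ord.
Qed.

Let TR_gt0 : 0 < T%:R :> R. Proof. by rewrite ltr0n. Qed.

Let good_reward_dev w k : ~ bad w ->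
  \sum_(t < T) (X k t w - mu k) <= Num.sqrt (l * T%:R).
Proof.
move=> /test_exp_small => /(_ (inr (Some k))).
rewrite /test_exp selected_expE /= (count_all (sel := fun=> Some k))//.
exact: chernoff_exponent.
Qed.

Let good_pulled_dev w : ~ bad w ->
  - Num.sqrt (l * T%:R) <= \sum_(t < T) (X (pull t w) t w - mu (pull t w)).
Proof.
move=> /test_exp_small => /(_ (inr None)).
rewrite /test_exp selected_expE /= (count_all (sel := fun s => Some (pull s w)))//.
rewrite lerNl sqrrN mulNr -mulrN.
exact: chernoff_exponent.
Qed.

Let measurable_pull t : discretely_measurable (pull t).
Proof.
by apply: (@measurable_pulled R K k0 C T delta B _ Omega _ W adv hadv U X t).
Qed.

Let measurable_se_regret : measurable_fun setT (se_regret hK C T delta B X U adv).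
Proof.
have mgain k : measurable_fun setT (fun w =>
    \sum_(0 <= t < T) (X k t w - X (pull t w) t w)).
  apply: measurable_sum => t; apply: measurable_funB => //.
  rewrite (_ : (fun w => _) =
    (fun w => \sum_i \1_[set w | pull t w = i] w * X i t w)); last first.
    apply/funext => w; rewrite (bigD1 (pull t w))//= big1 ?addr0.
      by rewrite indicE mem_set// mul1r.
    by move=> i /eqP neq; rewrite indicE memNset ?mul0r// => /esym.
  apply: measurable_sum => i; apply: measurable_funM => //.
  by apply: measurable_indic; exact: measurable_pull.
exact: measurable_bigmaxr.
Qed.

(** [D] and [v] stay free so that both stopping conditions are covered. Outside the bad event and
    the null set [N] the deterministic analysis applies. *)
Lemma se_regret_probability (D v : R) : 0 <= C -> 0 <= B -> 0 <= D ->
  (forall n : nat, B < n%:R -> 4 * se_width K C T delta n <= D) ->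
  2 * Num.sqrt (l * T%:R) +
    Num.min T%:R (6 * Num.sqrt (l * K%:R * T%:R) + 4 * K%:R * C + T%:R * D) <= v ->
  {ae P, forall w, se_total_attack hK C T delta B X U adv w <= C} ->
  ((1 - delta)%:E <= P [set w | se_regret hK C T delta B X U adv w <= v]%R)%E.
Proof.
move=> C0 B0 D0 hD hv [N [mN PN0 sN]].
set E := [set w | _].
have mE : measurable E by apply: measurable_ler_set.
have mu01 k : 0 <= mu k <= 1 by apply: mean_unit_ge0_le1; exact: (hnu.1 k).
have [best hbest] := hnu.2.
have best_max k : mu k <= mu best.
  by have [->//|/hbest/ltW] := eqVneq k best.
have sub : ~` E `<=` bad `|` N.
  move=> w nE; have [?|good] := pselect (bad w); [by left|right].
  apply: sN => att; apply: nE; rewrite /E/=.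
  apply: le_trans hv; rewrite addrC.
  apply: le_trans (regret_le_pseudo_regret best_max _ _) _.
  - by move=> k; exact: good_reward_dev.
  - exact: good_pulled_dev.
  rewrite lerD2r le_min; apply/andP; split; first exact: pseudo_regret_le_horizon.
  by apply: pseudo_regret_le => // k t tT; exact: good_concentration.
have PE : P E = (1 - P (~` E))%E by rewrite -probability_setC ?setCK//; exact: measurableC.
rewrite PE EFinB leeB//.
apply: (@le_trans _ _ (P (bad `|` N))).
  apply: le_measure; rewrite ?inE//; first exact: measurableC.
  exact: measurableU.
apply: le_trans (measureU2 _ _ _) _ => //.
by rewrite [X in (_ + X)%E]PN0 adde0; exact: prob_bad.
Qed.

End high_probability.

(** * Comparison with the stated rates *)

Section regret_rates.
Variables (R : realType) (K T : nat) (C delta : R).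
Hypotheses (hK : (2 <= K)%N) (hT : (1 <= T)%N) (C_ge0 : 0 <= C).
Hypothesis hdelta : 0 < delta < 1.

Let L := ln (K%:R * T%:R / delta).
Let l := ln (2 * K%:R * T%:R / delta).

Let KR : 2 <= K%:R :> R. Proof. by rewrite ler_nat. Qed.
Let TR : 1 <= T%:R :> R. Proof. by rewrite ler1n. Qed.
Let K_gt0 : 0 < K%:R :> R. Proof. exact: lt_le_trans KR. Qed.
Let T_gt0 : 0 < T%:R :> R. Proof. exact: lt_le_trans TR. Qed.

Let arg_gt2 : 2 < K%:R * T%:R / delta.
Proof.
have /andP[d0 d1] := hdelta.
by rewrite ltr_pdivlMr//; move: (K%:R) (T%:R) KR TR => a b ha hb; nra.
Qed.

Let l_ge0 : 0 <= l.
Proof.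
rewrite ln_ge0//; have /andP[d0 d1] := hdelta.
by rewrite ler_pdivlMr//; move: (K%:R) (T%:R) KR TR => a b ha hb; nra.
Qed.

Lemma log_gt0 : 0 < L.
Proof. by rewrite ln_gt0// (lt_trans _ arg_gt2)// ltr1n. Qed.

(** KT/delta > 2 gives ln 2 <= L, hence even l <= 2 L; the factor 4 is a perfect square, which
    leaves a factor 2 outside the square roots. *)
Lemma log2_le : l <= 4 * L.
Proof.
have L0 := log_gt0.
have a0 : 0 < K%:R * T%:R / delta by exact: lt_trans arg_gt2.
have -> : l = ln 2 + L.
  by rewrite /l -!mulrA lnM ?posrE// mulrA.
have : ln 2 <= L by rewrite ler_ln ?posrE// ltW.
by move=> h; lra.
Qed.

Let q := Num.sqrt (K%:R * T%:R * L).

Lemma sqrt_log2_le : Num.sqrt (l * K%:R * T%:R) <= 2 * q.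
Proof.
have -> : 2 * q = Num.sqrt (4 * L * K%:R * T%:R).
  rewrite (_ : 4 * L * K%:R * T%:R = 2 ^+ 2 * (K%:R * T%:R * L)); last by ring.
  by rewrite sqrtrM ?sqr_ge0// sqrtr_sqr ger0_norm.
by rewrite ler_wsqrtr// ler_wpM2r// ler_wpM2r// log2_le.
Qed.

Lemma sqrt_log2_horizon_le : Num.sqrt (l * T%:R) <= 2 * q.
Proof.
apply: le_trans sqrt_log2_le; rewrite ler_wsqrtr// ler_wpM2r//.
by rewrite ler_peMr// (le_trans _ KR)// ler1n.
Qed.

Lemma horizon_sqrt (a : R) : T%:R * Num.sqrt (a * K%:R / T%:R) = Num.sqrt (a * K%:R * T%:R).
Proof.
rewrite (_ : a * K%:R * T%:R = T%:R ^+ 2 * (a * K%:R / T%:R)).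
  by rewrite [RHS]sqrtrM ?sqr_ge0// sqrtr_sqr gtr0_norm.
by field; exact: lt0r_neq0.
Qed.

(** Here [s] is any bound on C / n, chosen according to the stopping condition. *)
Lemma se_width_le (n : nat) (s : R) : T%:R / K%:R < n%:R :> R -> C <= s * n%:R ->
  4 * se_width K C T delta n <= 4 * (Num.sqrt (l * K%:R / T%:R) + s).
Proof.
move=> hn hs.
have n0 : 0 < n%:R :> R by apply: le_lt_trans hn; rewrite divr_ge0 ?ltW.
rewrite ler_pM2l// /se_width -/l lerD//; last by rewrite ler_pdivrMr.
rewrite ler_wsqrtr// -mulrA ler_wpM2l// -[K%:R / _]invf_div lef_pV2 ?posrE ?divr_gt0//.
exact: ltW.
Qed.

(* The stopping threshold of part (i) makes C / n at most sqrt (L K / T). *)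
Lemma rate_inflated :
  2 * Num.sqrt (l * T%:R) + Num.min T%:R (6 * Num.sqrt (l * K%:R * T%:R) +
    4 * K%:R * C + T%:R * (4 * (Num.sqrt (l * K%:R / T%:R) +
                                Num.sqrt (L * K%:R / T%:R)))) <=
  32 * (q + K%:R * C).
Proof.
rewrite mulrCA mulrDr !horizon_sqrt.
have -> : Num.sqrt (L * K%:R * T%:R) = q by rewrite -mulrA mulrC.
have h1 := sqrt_log2_horizon_le; have h2 := sqrt_log2_le.
have q0 : 0 <= q by exact: sqrtr_ge0.
have kc : 0 <= K%:R * C by rewrite mulr_ge0// ltW.
rewrite -[4 * K%:R * C]mulrA; move: (K%:R * C) kc => kc kc0.
apply: (@le_trans _ _ (2 * Num.sqrt (l * T%:R) +
  (6 * Num.sqrt (l * K%:R * T%:R) + 4 * kc + 4 * (Num.sqrt (l * K%:R * T%:R) + q)))).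
  by rewrite lerD2l ge_min lexx orbT.
by lra.
Qed.

(** If KC <= T then (KC)^2 <= KTC, so KC is at most the target root; otherwise T^2 <= KTC and the
    horizon bound suffices. *)
Lemma rate_plain :
  2 * Num.sqrt (l * T%:R) + Num.min T%:R (6 * Num.sqrt (l * K%:R * T%:R) +
    4 * K%:R * C + T%:R * (4 * (Num.sqrt (l * K%:R / T%:R) + C * K%:R / T%:R))) <=
  32 * Num.sqrt (K%:R * T%:R * (L + C)).
Proof.
set r := Num.sqrt (K%:R * T%:R * (L + C)).
have L0 := log_gt0.
have qr : q <= r by rewrite ler_wsqrtr// ler_wpM2l ?mulr_ge0// lerDl.
have q0 : 0 <= q by exact: sqrtr_ge0.
have h1 := sqrt_log2_horizon_le; have h2 := sqrt_log2_le.
have sq_le a : 0 <= a -> a ^+ 2 <= K%:R * T%:R * C -> a <= r.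
  move=> a0 ha; rewrite -(ger0_norm a0) -sqrtr_sqr ler_wsqrtr//.
  apply: (le_trans ha); rewrite ler_wpM2l ?mulr_ge0// lerDr ltW//.
have [kc|kc] := leP (K%:R * C) T%:R.
  have kcr : K%:R * C <= r.
    apply: sq_le; first by rewrite mulr_ge0// ltW.
    by rewrite expr2 [leRHS]mulrAC ler_wpM2l ?mulr_ge0.
  rewrite [T%:R * _]mulrCA mulrDr horizon_sqrt.
  have -> : T%:R * (C * K%:R / T%:R) = K%:R * C by field; exact: lt0r_neq0.
  rewrite -[4 * K%:R * C]mulrA; move: (K%:R * C) kcr kc => a ar aT.
  apply: (@le_trans _ _ (2 * Num.sqrt (l * T%:R) +
    (6 * Num.sqrt (l * K%:R * T%:R) + 4 * a + 4 * (Num.sqrt (l * K%:R * T%:R) + a)))).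
    by rewrite lerD2l ge_min lexx orbT.
  by lra.
have Tr : T%:R <= r.
  apply: sq_le; first exact: ltW.
  by rewrite expr2 [leRHS]mulrAC ler_wpM2r// ltW.
apply: (@le_trans _ _ (2 * Num.sqrt (l * T%:R) + T%:R)).
  by rewrite lerD2l ge_min lexx.
by lra.
Qed.

End regret_rates.

Theorem theorem7 (R : realType) :
  exists2 c : R, 0 < c &
  forall (K : nat) (hK : (2 <= K)%N) (T : nat) (hT : (1 <= T)%N)
    (nu : 'I_K -> probability R R) (hnu : bandit_instance nu)
    (d : measure_display) (Omega : measurableType d) (P : probability Omega R)
    (X : 'I_K -> nat -> {RV P >-> R}) (hX : rewards_distributed T nu X)
    (dW : measure_display) (W : measurableType dW) (U : {mfun Omega >-> W})
    (hUX : independent_rounds T U X)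
    (adv : attack_policy R K W) (hadv : measurable_attack adv)
    (C : R) (hC : 0 <= C) (delta : R) (hdelta : 0 < delta < 1),
    let L := ln (K%:R * T%:R / delta) in
    (let B := T%:R / K%:R + C * Num.sqrt (T%:R / (K%:R * L)) in
     {ae P, forall w, se_total_attack hK C T delta B X U adv w <= C} ->
     ((1 - delta)%:E <=
       P [set w | se_regret hK C T delta B X U adv w <=
                  c * (Num.sqrt (K%:R * T%:R * L) + K%:R * C)]%R)%E)
    /\
    (let B := T%:R / K%:R in
     {ae P, forall w, se_total_attack hK C T delta B X U adv w <= C} ->
     ((1 - delta)%:E <=
       P [set w | se_regret hK C T delta B X U adv w <=
                  c * Num.sqrt (K%:R * T%:R * (L + C))]%R)%E).
Proof.
(* In part (ii) the terms add up to at most 24 sqrt (K T L) + 8 K C when K C <= T, whence 32; the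
   remaining bounds fit below it. *)
exists 32 => //.
move=> K hK T hT nu hnu d Omega P X hX dW W U hUX adv hadv C hC delta hdelta L.
have K0 : 0 < K%:R :> R by rewrite ltr0n; exact: leq_trans hK.
have T0 : 0 < T%:R :> R by rewrite ltr0n.
have L0 : 0 < L := log_gt0 hK hT hdelta.
split=> B hatt.
- have B0 : 0 <= B by rewrite addr_ge0 ?divr_ge0 ?mulr_ge0 ?sqrtr_ge0// ltW.
  apply: (se_regret_probability hT hnu hX hUX hadv hdelta hC B0 _ _
    (rate_inflated hK hT hC hdelta) hatt).
    by rewrite mulr_ge0// addr_ge0// sqrtr_ge0.
  move=> n hn; apply: se_width_le => //.
    apply: le_lt_trans hn; rewrite lerDl mulr_ge0// sqrtr_ge0.
  (* The second summand of [B] is C / s, so n > B gives C <= s n. *)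
  set s := Num.sqrt (L * K%:R / T%:R).
  have s0 : 0 < s by rewrite sqrtr_gt0 divr_gt0// mulr_gt0.
  have e : Num.sqrt (T%:R / (K%:R * L)) = s^-1.
    rewrite -sqrtrV; last by rewrite divr_ge0 ?mulr_ge0// ltW.
    by rewrite invf_div [L * _]mulrC.
  rewrite mulrC -ler_pdivrMr// -e ltW//; apply: le_lt_trans hn.
  by rewrite lerDr divr_ge0 ?ltW.
- have B0 : 0 <= B by rewrite divr_ge0 ?ltW.
  apply: (se_regret_probability hT hnu hX hUX hadv hdelta hC B0 _ _
    (rate_plain hK hT hC hdelta) hatt).
    by rewrite mulr_ge0// addr_ge0 ?sqrtr_ge0// divr_ge0// mulr_ge0.
  move=> n hn; apply: se_width_le => //.
  (* Here s = C K / T, and n > T / K gives C <= s n. *)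
  have e : C = C * K%:R / T%:R * (T%:R / K%:R) by field; rewrite !lt0r_neq0.
  rewrite [leLHS]e.
  by rewrite ler_wpM2l ?divr_ge0 ?mulr_ge0// ltW.
Qed.
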